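(* Let $\Gamma$ and $\Delta$ be finite or countable $\omega$-categorical structures. Then: \begin{itemize} \item $\Delta$ has a primitive positive interpretation in $\Gamma$ if and only if $\Delta$ is a reduct of a finite or $\omega$-categorical structure $\Delta'$ such that there exists a continuous clone homomorphism from $\mathrm{Pol}(\Gamma)$ into $\mathrm{Pol}(\Delta')$ whose image is dense in $\mathrm{Pol}(\Delta')$. \item $\Gamma$ and $\Delta$ are primitive positive bi-interpretable if and only if their polymorphism clones $\mathrm{Pol}(\Gamma)$ and $\mathrm{Pol}(\Delta)$ are isomorphic as topological clones. \end{itemize}
   Context: Structures may have relations and functions in their signature. A countable structure is $\omega$-categorical iff all countable models of its first-order theory are isomorphic to it; all $\omega$-categorical structures are assumed countable. A reduct of a structure $\Delta'$ is a structure on the same domain obtained by forgetting some relations or functions of $\Delta'$. Polymorphism clones. A polymorphism of $\Gamma$ is a homomorphism from $\Gamma^k$ to $\Gamma$ for some finite $k\ge 1$; $\mathrm{Pol}(\Gamma)$ is the set of all polymorphisms. For a set $D$, let $\mathcal O_D=\bigcup_{k\ge1}D^{D^k}$ be the set of finitary functions on $D$, topologized as the sum space of the spaces $D^{D^k}$, where $D$ is discrete and $D^{D^k}$ has the product topology; $\mathrm{Pol}(\Gamma)$ carries the subspace topology. A (concrete) clone is a set of finitary functions on a fixed set that contains all projections and is closed under composition. A clone homomorphism $\xi\colon\mathscr C\to\mathscr D$ is a function (preserving arities) that sends every projection to the corresponding projection and satisfies $\xi(f(g_1,\dots,g_n))=\xi(f)(\xi(g_1),\dots,\xi(g_n))$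 for all $n$-ary $f\in\mathscr C$ and all $m$-ary $g_1,\dots,g_n\in\mathscr C$. Two clones are isomorphic as topological clones iff there is a bijection $\xi$ between them such that $\xi$ and $\xi^{-1}$ are continuous clone homomorphisms. Interpretations. A primitive positive formula is one of the form $\exists x_1,\dots,x_n(\phi_1\wedge\dots\wedge\phi_m)$ with all $\phi_i$ atomic. An atomic formula is unnested iff it has the form $x_0=x_1$, $x_0=f(x_1,\dots,x_n)$ or $R(x_1,\dots,x_n)$ with $f$ a function symbol, $R$ a relation symbol and $x_i$ variables. A $\sigma$-structure $\Delta$ has a (first-order) interpretation $I$ in a $\tau$-structure $\Gamma$ iff there are $d\ge1$ (the dimension), a $\tau$-formula $\delta_I(x_1,\dots,x_d)$ (domain formula), for each unnested atomic $\sigma$-formula $\phi(y_1,\dots,y_k)$ a $\tau$-formula $\phi_I(\overline x_1,\dots,\overline x_k)$ where the $\overline x_i$ are disjoint $d$-tuples of distinct variables (defining formulas), and a surjective map $h\colon\delta_I(\Gamma^d)\to\Delta$ (coordinate map; $\delta_I(\Gamma^d)$ is the $d$-ary relation defined by $\delta_I$ in $\Gamma$), such that for every unnested atomic $\sigma$-formula $\phi$ and all $\overline a_i\in\delta_I(\Gamma^d)$: $\Delta\models\phi(h(\overline a_1),\dots,h(\overline a_k))\Leftrightarrow\Gamma\models\phi_I(\overline a_1,\dots,\overline a_k)$. It is primitive positive iff $\delta_I$ and all $\phi_I$ are primitive positive. One writes $I=(d,S,h)$ with $S=\delta_I(\Gamma^d)$. $\Gamma$ and $\Delta$ are primitive positive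 bi-interpretable iff there are a primitive positive interpretation $I=(d_1,S_1,h_1)$ of $\Delta$ in $\Gamma$ and a primitive positive interpretation $J=(d_2,S_2,h_2)$ of $\Gamma$ in $\Delta$ such that the $(1+d_1d_2)$-ary relation $x=h_1(h_2(y_{1,1},\dots,y_{1,d_2}),\dots,h_2(y_{d_1,1},\dots,y_{d_1,d_2}))$ is primitive positive definable in $\Delta$, and the $(1+d_1d_2)$-ary relation $x=h_2(h_1(y_{1,1},\dots,y_{1,d_1}),\dots,h_1(y_{d_2,1},\dots,y_{d_2,d_1}))$ is primitive positive definable in $\Gamma$.
   Formalization: Domains are nonempty, falsity counts as an atomic formula (so it may occur in primitive positive formulas), and ω-categorical structures, including Δ', are required to have a countable signature; the claim fails as literally stated without these conventions. *)

(* Defs.v *)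
From HB Require Import structures.
From mathcomp Require Import all_boot all_classical topology.

Set Implicit Arguments.
Unset Strict Implicit.
Unset Printing Implicit Defensive.

Local Open Scope classical_set_scope.

Record signature : Type := Signature {
  relsym : Type;
  funsym : Type;
  rarity : relsym -> nat;
  farity : funsym -> nat }.

Definition countable_signature (s : signature) : Prop :=
  countable [set: relsym s] /\ countable [set: funsym s].

Record structure (s : signature) (D : Type) : Type := Structure {
  relI : forall r : relsym s, set ('I_(rarity r) -> D);
  funI : forall f : funsym s, ('I_(farity f) -> D) -> D }.

(* First-order syntax; [V] is the type of the free variables, and [FEx] binds
   the variable [None] of [option V]. Falsity is an atomic formula: without it
   the empty relation, which every function preserves, need not be primitive
   positive definable. *)
Inductive term (s : signature) (V : Type) : Type :=
| Var of V
| App (f : funsym s) of ('I_(farity f) -> term s V).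

Inductive formula (s : signature) (V : Type) : Type :=
| FFalse
| FEq of term s V & term s V
| FRel (r : relsym s) of ('I_(rarity r) -> term s V)
| FNot of formula s V
| FAnd of formula s V & formula s V
| FEx of formula s (option V).

Arguments Var {s V} _.
Arguments App {s V} f _.
Arguments FFalse {s V}.
Arguments FEq {s V} _ _.
Arguments FRel {s V} r _.

Fixpoint teval (s : signature) (D : Type) (G : structure s D) (V : Type)
    (v : V -> D) (t : term s V) : D :=
  match t with
  | Var x => v x
  | App f ts => funI G (fun i => teval G v (ts i))
  end.

Fixpoint holds (s : signature) (D : Type) (G : structure s D) (V : Type)
    (v : V -> D) (phi : formula s V) {struct phi} : Prop :=
  match phi with
  | FFalse => False
  | FEq t u => teval G v t = teval G v u
  | FRel r ts => relI G (fun i => teval G v (ts i))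
  | FNot psi => ~ holds G v psi
  | FAnd psi chi => holds G v psi /\ holds G v chi
  | FEx psi => exists x : D, holds G (oapp v x) psi
  end.

Fixpoint atomic_conjunction (s : signature) (V : Type) (phi : formula s V) : bool :=
  match phi with
  | FFalse | FEq _ _ | FRel _ _ => true
  | FAnd psi chi => atomic_conjunction psi && atomic_conjunction chi
  | _ => false
  end.

Fixpoint primitive_positive (s : signature) (V : Type) (phi : formula s V) : bool :=
  match phi with
  | FEx psi => primitive_positive psi
  | psi => atomic_conjunction psi
  end.

Definition unnested_atomic (s : signature) (V : Type) (phi : formula s V) : Prop :=
  [\/ exists x y : V, phi = FEq (Var x) (Var y),
      exists (x : V) (f : funsym s) (xs : 'I_(farity f) -> V),
        phi = FEq (Var x) (App f (fun i => Var (xs i)))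
    | exists (r : relsym s) (xs : 'I_(rarity r) -> V),
        phi = FRel r (fun i => Var (xs i))].

Definition pp_definable (s : signature) (D : Type) (G : structure s D)
    (V : Type) (A : set (V -> D)) : Prop :=
  exists2 phi : formula s V, primitive_positive phi &
    A = [set v | holds G v phi].

Definition models_theory (s : signature) (D E : Type)
    (G : structure s D) (M : structure s E) : Prop :=
  forall phi : formula s void,
    holds G (of_void D) phi -> holds M (of_void E) phi.

Definition homomorphism (s : signature) (D E : Type)
    (G : structure s D) (H : structure s E) (h : D -> E) : Prop :=
  (forall (r : relsym s) a, relI G a -> relI H (r := r) (h \o a)) /\
  (forall (f : funsym s) a, h (funI G a) = funI H (f := f) (h \o a)).

Definition isomorphic (s : signature) (D E : Type)
    (G : structure s D) (H : structure s E) : Prop :=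
  exists (h : D -> E) (h' : E -> D),
    [/\ cancel h h', cancel h' h, homomorphism G H h & homomorphism H G h'].

(* Countably infinite; the language is part of the data and is taken countable,
   as usual for omega-categoricity. *)
Definition omega_categorical (s : signature) (D : Type) (G : structure s D) : Prop :=
  [/\ ([set: D] #= [set: nat])%card, countable_signature s &
      forall (E : Type) (M : structure s E),
        ([set: E] #= [set: nat])%card -> models_theory G M -> isomorphic G M].

Definition finite_or_omega_categorical (s : signature) (D : Type)
    (G : structure s D) : Prop :=
  finite_set [set: D] \/ omega_categorical G.

(* [H] is obtained from [H'] by forgetting the symbols outside the images of
   [iR] and [iF]; the equalities of dependent pairs state that arities and
   interpretations agree. *)
Definition reduct (s s' : signature) (E : Type)
    (H : structure s E) (H' : structure s' E) : Prop :=
  exists (iR : relsym s -> relsym s') (iF : funsym s -> funsym s'),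
    [/\ injective iR, injective iF,
        forall r, existT (fun n => set ('I_n -> E)) _ (@relI _ _ H' (iR r)) =
                  existT (fun n => set ('I_n -> E)) _ (@relI _ _ H r) &
        forall f, existT (fun n => ('I_n -> E) -> E) _ (@funI _ _ H' (iF f)) =
                  existT (fun n => ('I_n -> E) -> E) _ (@funI _ _ H f)].

(* Variable [(i, j)] of a defining formula is the [j]-th entry of the [i]-th
   tuple. The coordinate map is total, but only its values on the tuples
   satisfying [idom] matter. *)
Record interpretation (s t : signature) (D E : Type)
    (H : structure s E) (G : structure t D) : Type := Interpretation {
  idim : nat;
  idom : formula t 'I_idim;
  idef : forall k : nat, formula s 'I_k -> formula t ('I_k * 'I_idim);
  icoord : ('I_idim -> D) -> E;
  idim_gt0 : (0 < idim)%N;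
  icoord_surj : forall e : E, exists2 a, holds G a idom & icoord a = e;
  idefP : forall (k : nat) (phi : formula s 'I_k), unnested_atomic phi ->
    forall a : 'I_k -> 'I_idim -> D, (forall i, holds G (a i) idom) ->
      (holds H (fun i => icoord (a i)) phi <->
       holds G (fun ij => a ij.1 ij.2) (idef phi)) }.

Arguments idom {s t D E H G} _.
Arguments idef {s t D E H G} _ {k} _.
Arguments icoord {s t D E H G} _ _.

Definition interp_dom (s t : signature) (D E : Type)
    (H : structure s E) (G : structure t D) (I : interpretation H G) :
    set ('I_(idim I) -> D) :=
  [set a | holds G a (idom I)].
Arguments interp_dom {s t D E H G} _ _.

Definition pp_interpretation (s t : signature) (D E : Type)
    (H : structure s E) (G : structure t D) (I : interpretation H G) : Prop :=
  primitive_positive (idom I) /\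
  forall (k : nat) (phi : formula s 'I_k),
    unnested_atomic phi -> primitive_positive (idef I phi).

Definition pp_interpretable (s t : signature) (D E : Type)
    (H : structure s E) (G : structure t D) : Prop :=
  exists I : interpretation H G, pp_interpretation I.

(* The relation x = h_I(h_J(y_1), ..., h_J(y_d)), with d the dimension of [I],
   on the tuples where the right-hand side is defined; [None] is the position
   of x and [Some (i, j)] the position of y_{i,j}. *)
Definition composite_graph (s t : signature) (D E : Type)
    (H : structure s E) (G : structure t D)
    (I : interpretation H G) (J : interpretation G H) :
    set (option ('I_(idim I) * 'I_(idim J)) -> E) :=
  [set v |
    let y (i : 'I_(idim I)) (j : 'I_(idim J)) := v (Some (i, j)) in
    [/\ forall i, interp_dom J (y i),
        interp_dom I (fun i => icoord J (y i)) &
        v None = icoord I (fun i => icoord J (y i))]].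
Arguments composite_graph {s t D E H G} I J _.

Definition pp_bi_interpretable (s t : signature) (D E : Type)
    (G : structure t D) (H : structure s E) : Prop :=
  exists (I : interpretation H G) (J : interpretation G H),
    [/\ pp_interpretation I, pp_interpretation J,
        pp_definable H (composite_graph I J) &
        pp_definable G (composite_graph J I)].

(* [op D k] is the space of operations of arity [k.+1], so that [ops D] is the
   sum space of all finitary operations of positive arity. *)
Definition op (D : pointedType) (k : nat) :=
  {ptws ('I_k.+1 -> D) -> discrete_topology D}.

Definition ops (D : pointedType) := {k : nat & op D k}.

Definition proj_op (D : pointedType) (k : nat) (i : 'I_k.+1) : op D k :=
  fun x => x i.

Definition comp_op (D : pointedType) (n m : nat) (f : op D n)
    (g : 'I_n.+1 -> op D m) : op D m :=
  fun x => f (fun i => g i x).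

Definition power (s : signature) (D : Type) (G : structure s D) (k : nat) :
    structure s ('I_k -> D) :=
  {| relI := fun r a => forall j, relI G (r := r) (fun i => a i j);
     funI := fun f a j => funI G (f := f) (fun i => a i j) |}.

Definition Pol (s : signature) (D : pointedType) (G : structure s D) :
    set (ops D) :=
  [set f | homomorphism (power G (projT1 f).+1) G (projT2 f)].
Arguments Pol {s D} G _.

(* Maps of clones are given arity by arity, hence preserve arities; they are
   defined on all operations, but only their values on the clone matter. *)
Definition ops_map (D E : pointedType) (xi : forall k, op D k -> op E k) :
    ops D -> ops E :=
  fun f => existT _ (projT1 f) (xi _ (projT2 f)).

Definition clone_homomorphism (D E : pointedType) (C : set (ops D))
    (C' : set (ops E)) (xi : forall k, op D k -> op E k) : Prop :=
  [/\ forall f, C f -> C' (ops_map xi f),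
      forall (k : nat) (i : 'I_k.+1), xi k (proj_op i) = proj_op i &
      forall (n m : nat) (f : op D n) (g : 'I_n.+1 -> op D m),
        C (existT _ n f) -> (forall i, C (existT _ m (g i))) ->
        xi m (comp_op f g) = comp_op (xi n f) (fun i => xi m (g i))].

Definition continuous_clone_homomorphism (D E : pointedType) (C : set (ops D))
    (C' : set (ops E)) (xi : forall k, op D k -> op E k) : Prop :=
  clone_homomorphism C C' xi /\ {within C, continuous (ops_map xi)}.

Definition topological_clone_isomorphic (D E : pointedType) (C : set (ops D))
    (C' : set (ops E)) : Prop :=
  exists (xi : forall k, op D k -> op E k) (zeta : forall k, op E k -> op D k),
    [/\ continuous_clone_homomorphism C C' xi,
        continuous_clone_homomorphism C' C zeta,
        {in C, cancel (ops_map xi) (ops_map zeta)} &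
        {in C', cancel (ops_map zeta) (ops_map xi)}].

(* Main.v *)
Require Import Defs.
From HB Require Import structures.
From mathcomp Require Import all_boot all_classical topology.

Set Implicit Arguments.
Unset Strict Implicit.
Unset Printing Implicit Defensive.

Local Open Scope classical_set_scope.

(** Why the theorem holds. Categoricity enters through a finiteness property of
    Ryll-Nardzewski type: up to equivalence there are finitely many formulas in
    given variables ([omega_categorical_formulas]), or, what amounts to the same
    by back-and-forth, automorphisms have finitely many orbits on tuples
    ([formulas_oligomorphic], [oligomorphic_omega_categorical]). Finite
    structures have this property as well, and the rest of the argument starts
    from it; cardinalities and countable signatures return only when the expansion
    below is shown to be omega-categorical. To get the property from categoricity, two
    countable models are compared with [G]. A countable elementary substructure
    of an ultrapower realizes a decreasing sequence of satisfiable formulas;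
    being isomorphic to [G], it shows that [G] does so. An elementary
    substructure of [G] built from isolated tuples shows that all tuples of [G]
    are isolated. Hence finitely many isolating formulas exhaust the tuples,
    since their negations are not realized together.

    The link between formulas and operations is [preserved_pp_definable]: a
    relation preserved by all polymorphisms is primitive positive definable. It
    is the image, under all homomorphisms from a power of [G], of one tuple whose
    coordinates represent the orbits in the relation, and by [pp_implies_hom]
    such homomorphisms are governed by primitive positive formulas.

    Given an interpretation, polymorphisms of [G] act coordinatewise on its
    domain and this action passes to the quotient by the kernel of the coordinate
    map, because domain and kernel are primitive positive definable
    ([interpretation_clone_homomorphism]). The image is dense in the polymorphism
    clone of the expansion by all relations whose preimage is definable
    ([expansion_dense]).

    Given a continuous clone homomorphism [xi] with dense image, every point of
    [E] is a value [xi k f b] at one fixed tuple [b] that meets all orbits. By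
    compactness modulo automorphisms, continuity is uniform
    ([uniformly_continuous]), so that [xi k f b] depends on the restriction of
    [f] to one fixed finite set. These restrictions form a relation on which
    [xi k f b] is a coordinate map, and whatever has to be defined is preserved
    by polymorphisms ([clone_homomorphism_interpretation]).

    In both constructions the coordinate map commutes with the actions of the
    two clones, which is the predicate [induces]. For bi-interpretations this
    turns the definability of the composed coordinate maps into the statement
    that the two homomorphisms are inverse to each other, and conversely
    ([composite_graph_cancel], [cancel_composite_graph]). *)

(** * Syntax of formulas *)

Fixpoint rename_term (s : signature) (V W : Type) (u : V -> W) (t : term s V) :
    term s W :=
  match t with
  | Var x => Var (u x)
  | App f ts => App f (fun i => rename_term u (ts i))
  end.

Fixpoint rename (s : signature) (V W : Type) (u : V -> W) (phi : formula s V)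
    {struct phi} : formula s W :=
  match phi with
  | FFalse => FFalse
  | FEq t t' => FEq (rename_term u t) (rename_term u t')
  | FRel r ts => FRel r (fun i => rename_term u (ts i))
  | FNot psi => FNot (rename u psi)
  | FAnd psi chi => FAnd (rename u psi) (rename u chi)
  | FEx psi => FEx (rename (omap u) psi)
  end.

Lemma teval_rename (s : signature) (D : Type) (G : structure s D) (V W : Type)
    (u : V -> W) (v : W -> D) (t : term s V) :
  teval G v (rename_term u t) = teval G (v \o u) t.
Proof. by elim: t => //= f ts IH; congr funI; apply/funext => i. Qed.

Lemma oapp_omap (A B C : Type) (u : A -> B) (v : B -> C) (x : C) :
  oapp v x \o omap u = oapp (v \o u) x.
Proof. by apply/funext => -[]. Qed.

Lemma holds_rename (s : signature) (D : Type) (G : structure s D) (V : Type)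
    (phi : formula s V) (W : Type) (u : V -> W) (v : W -> D) :
  holds G v (rename u phi) = holds G (v \o u) phi.
Proof.
elim: phi W u v => //= {V}.
- by move=> V t t' W u v; rewrite !teval_rename.
- move=> V r ts W u v; congr (relI G _).
  by apply/funext => i; rewrite teval_rename.
- by move=> V phi IH W u v; rewrite IH.
- by move=> V phi IH psi IH' W u v; rewrite IH IH'.
- move=> V phi IH W u v; congr ex; apply/funext => x.
  by rewrite IH oapp_omap.
Qed.

Lemma atomic_conjunction_rename (s : signature) (V : Type) (phi : formula s V)
    (W : Type) (u : V -> W) :
  atomic_conjunction (rename u phi) = atomic_conjunction phi.
Proof. by elim: phi W u => //= {}V phi IH psi IH' W u; rewrite IH IH'. Qed.

Lemma primitive_positive_rename (s : signature) (V : Type) (phi : formula s V)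
    (W : Type) (u : V -> W) :
  primitive_positive (rename u phi) = primitive_positive phi.
Proof.
elim: phi W u => //= {}V phi _ psi _ W u.
by rewrite !atomic_conjunction_rename.
Qed.

(** Quantifiers are pulled in front one at a time, the other conjunct being
    weakened along [Some]. *)
Lemma pp_conj (s : signature) (V : Type) (phi psi : formula s V) :
  primitive_positive phi -> primitive_positive psi ->
  exists2 chi : formula s V, primitive_positive chi &
    forall (D : Type) (G : structure s D) (v : V -> D),
      holds G v chi <-> holds G v phi /\ holds G v psi.
Proof.
have weaken (U : Type) (theta : formula s U) D (G : structure s D) v x :
    holds G (oapp v x) (rename Some theta) = holds G v theta.
  by rewrite holds_rename; congr holds; apply/funext.
have conjA (U : Type) (theta : formula s U) (rho : formula s U) :
    atomic_conjunction theta -> primitive_positive rho ->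
    exists2 chi : formula s U, primitive_positive chi &
      forall (D : Type) (G : structure s D) (v : U -> D),
      holds G v chi <-> holds G v theta /\ holds G v rho.
  elim: rho theta => {U}.
  - by move=> U theta pt pr; exists (FAnd theta FFalse) => //=; rewrite pt.
  - by move=> U t u theta pt pr; exists (FAnd theta (FEq t u)) => //=; rewrite pt.
  - by move=> U t u theta pt pr; exists (FAnd theta (FRel t u)) => //=; rewrite pt.
  - by [].
  - move=> U r1 _ r2 _ theta pt pr.
    by exists (FAnd theta (FAnd r1 r2)) => //=; move: pr => /= ->; rewrite pt.
  - move=> U rho IH theta pt pr.
    have [|chi pchi chiP] := IH (rename Some theta) _ pr.
      by rewrite atomic_conjunction_rename.
    exists (FEx chi) => //= D G v; split.
      by move=> [x /chiP []]; rewrite weaken; split => //; exists x.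
    by move=> [tv [x rx]]; exists x; apply/chiP; rewrite weaken.
elim: phi psi => {V}.
- by move=> V psi pp; apply: conjA.
- by move=> V t u psi pp; apply: conjA.
- by move=> V t u psi pp; apply: conjA.
- by [].
- by move=> V r1 _ r2 _ psi pp; apply: conjA.
- move=> V phi IH psi pphi ppsi.
  have [|chi pchi chiP] := IH (rename Some psi) pphi.
    by rewrite primitive_positive_rename.
  exists (FEx chi) => //= D G v; split.
    by move=> [x /chiP []]; rewrite weaken; split => //; exists x.
  by move=> [[x rx] tv]; exists x; apply/chiP; rewrite weaken.
Qed.

Lemma term_support (s : signature) (V : Type) (t : term s V) (f : V -> nat) :
  exists N, forall (D : Type) (G : structure s D) (v w : V -> D),
    (forall x, f x < N -> v x = w x) -> teval G v t = teval G w t.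
Proof.
elim: t => /= [x|g ts IH]; first by exists (f x).+1 => D G v w; apply.
have /choice[N NP] := IH.
exists (\max_i N i) => D G v w vw; congr funI; apply/funext => i.
by apply: NP => x xN; apply: vw; apply: leq_trans xN (leq_bigmax i).
Qed.

(** The map [f] numbers the variables, so that the statement stays meaningful
    under quantifiers, which enlarge the set of variables. *)
Lemma formula_support (s : signature) (V : Type) (phi : formula s V)
    (f : V -> nat) :
  exists N, forall (D : Type) (G : structure s D) (v w : V -> D),
    (forall x, f x < N -> v x = w x) -> holds G v phi = holds G w phi.
Proof.
elim: phi f => /= {V}.
- by move=> V f; exists 0.
- move=> V t u f; have [N NP] := term_support t f.
  have [M MP] := term_support u f; exists (maxn N M) => D G v w vw.
  rewrite (NP D G v w) ?(MP D G v w) // => x xlt;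
    by apply: vw; rewrite leq_max xlt ?orbT.
- move=> V r ts f.
  have /choice[N NP] := fun i => term_support (ts i) f.
  exists (\max_i N i) => D G v w vw; congr (relI G _); apply/funext => i.
  by apply: NP => x xN; apply: vw; apply: leq_trans xN (leq_bigmax i).
- move=> V phi IH f; have [N NP] := IH f.
  by exists N => D G v w /NP ->.
- move=> V phi IH psi IH' f; have [N NP] := IH f; have [M MP] := IH' f.
  exists (maxn N M) => D G v w vw; rewrite (NP D G v w) ?(MP D G v w) // => x xlt;
    by apply: vw; rewrite leq_max xlt ?orbT.
- move=> V phi IH f; have [N NP] := IH (oapp f 0).
  exists N => D G v w vw; congr ex; apply/funext => x.
  by apply: NP => -[y|] //= /vw.
Qed.

Definition FImp (s : signature) (V : Type) (phi psi : formula s V) :=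
  FNot (FAnd phi (FNot psi)).

Definition FAll (s : signature) (V : Type) (phi : formula s (option V)) :=
  FNot (FEx (FNot phi)).

Lemma holds_FImp (s : signature) (D : Type) (G : structure s D) (V : Type)
    (v : V -> D) (phi psi : formula s V) :
  holds G v (FImp phi psi) <-> (holds G v phi -> holds G v psi).
Proof.
split=> /= [H h|H [h]]; last by apply; apply: H.
by apply: contrapT => nh; apply: H.
Qed.

Lemma holds_FAll (s : signature) (D : Type) (G : structure s D) (V : Type)
    (v : V -> D) (phi : formula s (option V)) :
  holds G v (FAll phi) <-> forall x, holds G (oapp v x) phi.
Proof.
split=> /= [H x|H [x]]; last by apply.
by apply: contrapT => nh; apply: H; exists x.
Qed.

Arguments CodeSeq.code : simpl never.

Fixpoint code_term (s : signature) (V : Type) (cf : funsym s -> nat)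
    (cv : V -> nat) (t : term s V) : nat :=
  match t with
  | Var x => CodeSeq.code [:: 0; cv x]
  | App f ts =>
      CodeSeq.code [:: 1, cf f & [seq code_term cf cv (ts i) | i <- enum 'I_(farity f)]]
  end.

Fixpoint code_formula (s : signature) (V : Type) (cr : relsym s -> nat)
    (cf : funsym s -> nat) (cv : V -> nat) (phi : formula s V) {struct phi} : nat :=
  match phi with
  | FFalse => CodeSeq.code [:: 0]
  | FEq t u => CodeSeq.code [:: 1; code_term cf cv t; code_term cf cv u]
  | FRel r ts =>
      CodeSeq.code [:: 2, cr r & [seq code_term cf cv (ts i) | i <- enum 'I_(rarity r)]]
  | FNot psi => CodeSeq.code [:: 3; code_formula cr cf cv psi]
  | FAnd psi chi =>
      CodeSeq.code [:: 4; code_formula cr cf cv psi; code_formula cr cf cv chi]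
  | FEx psi => CodeSeq.code [:: 5; code_formula cr cf (oapp (S \o cv) 0) psi]
  end.

Lemma code_seq_inj : injective CodeSeq.code.
Proof. exact: can_inj CodeSeq.codeK. Qed.

Lemma map_enum_inj (I : finType) (T : Type) (f g : I -> T) :
  map f (enum I) = map g (enum I) -> f = g.
Proof.
move=> /eq_in_map fg; apply/funext => i.
by apply: fg; rewrite mem_enum.
Qed.

Lemma code_term_inj (s : signature) (V : Type) (cf : funsym s -> nat)
    (cv : V -> nat) :
  injective cf -> injective cv -> injective (code_term cf cv).
Proof.
move=> cf_inj cv_inj; elim=> [x|f ts IH] [y|g us] //= /code_seq_inj //.
- by move=> [/cv_inj ->].
- move=> [/cf_inj E]; move: us; rewrite -E => us.
  move=> /map_enum_inj /funeqP E'.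
  by congr App; apply/funext => i; apply: IH; exact: E'.
Qed.

Lemma code_formula_inj (s : signature) (V : Type) (cr : relsym s -> nat)
    (cf : funsym s -> nat) (cv : V -> nat) :
  injective cr -> injective cf -> injective cv ->
  injective (code_formula cr cf cv).
Proof.
move=> cr_inj cf_inj cv_inj phi; elim: phi cv cv_inj => {V}.
- by move=> V cv cv_inj [] //= > /code_seq_inj.
- move=> V t u cv cv_inj; case=> /=; try by move=> > /code_seq_inj.
  by move=> t' u' /code_seq_inj[] /(code_term_inj cf_inj cv_inj) ->
    /(code_term_inj cf_inj cv_inj) ->.
- move=> V r ts cv cv_inj; case=> /=; try by move=> > /code_seq_inj.
  move=> r' us /code_seq_inj[] /cr_inj E; move: us; rewrite -E => us.
  move=> /map_enum_inj /funeqP E'.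
  congr FRel; apply/funext => i; apply: (code_term_inj cf_inj cv_inj).
  exact: E'.
- move=> V phi IH cv cv_inj; case=> /=; try by move=> > /code_seq_inj.
  by move=> psi /code_seq_inj[] /(IH _ cv_inj) ->.
- move=> V phi IH psi IH' cv cv_inj; case=> /=; try by move=> > /code_seq_inj.
  by move=> phi' psi' /code_seq_inj[] /(IH _ cv_inj) -> /(IH' _ cv_inj) ->.
- move=> V phi IH cv cv_inj; case=> /=; try by move=> > /code_seq_inj.
  move=> psi /code_seq_inj[] /IH -> //.
  by move=> [x|] [y|] //= [] /cv_inj ->.
Qed.

Lemma countable_formula (s : signature) (V : Type) :
  countable_signature s -> countable [set: V] -> countable [set: formula s V].
Proof.
have inj_of (T : Type) : countable [set: T] -> exists f : T -> nat, injective f.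
  move=> /countable_injP[f fi]; exists f => x y; apply: fi; exact: mem_set.
move=> [/inj_of[cr cri] /inj_of[cf cfi]] /inj_of[cv cvi].
apply/countable_injP; exists (code_formula cr cf cv) => x y _ _.
exact: code_formula_inj.
Qed.

(** * Enumerations and generic constructions *)

Definition enumerable (T : Type) := exists e : nat -> T, forall x, exists n, e n = x.

Lemma exists_member_if_any (T : Type) (P : set T) (x0 : T) :
  exists x, forall y, P y -> P x.
Proof.
have [[y Py]|no] := pselect (exists y, P y); first by exists y.
by exists x0 => y Py; case: no; exists y.
Qed.

Lemma enumerable_countable (T : Type) (x0 : T) :
  countable [set: T] -> enumerable T.
Proof.
move=> /countable_injP[f f_inj].
have /choice[e eP] := fun n => exists_member_if_any [set x | f x = n] x0.
exists e => x; exists (f x); apply: f_inj; rewrite ?inE //.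
exact: (eP (f x) x).
Qed.

Lemma enumerable_ffun (V : finType) (T : Type) : enumerable T -> enumerable (V -> T).
Proof.
move=> [e e_surj].
exists (fun n x => e (nth 0 (CodeSeq.decode n) (enum_rank x))) => v.
have /choice[c cP] := fun x => e_surj (v x).
exists (CodeSeq.code [seq c x | x <- enum V]).
rewrite CodeSeq.codeK; apply/funext => x.
by rewrite (nth_map x) ?nth_enum_rank // -cardE ltn_ord.
Qed.

Lemma dependent_chain (T : Type) (P : T -> Prop) (R : nat -> T -> T -> Prop) (t0 : T) :
  P t0 -> (forall n t, P t -> exists2 t', P t' & R n t t') ->
  exists c : nat -> T,
    [/\ c 0 = t0, forall n, P (c n) & forall n, R n (c n) (c n.+1)].
Proof.
move=> P0 step.
have /choice[next nextP] : forall nt : nat * {t | P t},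
    exists t' : {t | P t}, R nt.1 (sval nt.2) (sval t').
  by move=> [n [t Pt]]; have [t' Pt' Rt'] := step n t Pt; exists (exist _ t' Pt').
pose c := fix c n := if n is m.+1 then next (m, c m) else exist _ t0 P0.
exists (fun n => sval (c n)); split => // n; first exact: svalP.
exact: (nextP (n, c n)).
Qed.

Lemma chain_homo (T : Type) (c : nat -> set T) :
  (forall n, c n `<=` c n.+1) -> forall m n, m <= n -> c m `<=` c n.
Proof.
move=> cS m n /subnKC <-; elim: (n - m) => [|k IH]; first by rewrite addn0.
by rewrite addnS; apply: subset_trans (cS _).
Qed.

(** The common core of all back-and-forth arguments: a finite approximation is
    enlarged one point at a time so as to meet countably many requirements;
    what matters of the union [F] is that each finite part of it lies in an
    approximation. *)
Lemma generic_union (X : Type) (P : set X -> Prop) (Q : nat -> X -> Prop)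
    (p0 : set X) :
  P p0 -> (forall n p, P p -> exists2 x, Q n x & P (p `|` [set x])) ->
  exists F : set X,
    [/\ p0 `<=` F, forall n, exists2 x, Q n x & F x &
        forall (V : finType) (u : V -> X), (forall i, F (u i)) ->
          exists p, [/\ P p, p0 `<=` p, p `<=` F & forall i, p (u i)]].
Proof.
move=> P0 step.
have [|c [c0 cP cR]] := @dependent_chain _ P
    (fun n p p' => p `<=` p' /\ exists2 x, Q n x & p' x) _ P0.
  move=> n p /(step n)[x Qx Px]; exists (p `|` [set x]) => //.
  by split; [exact: subsetUl | exists x => //; right].
have cle := @chain_homo _ c (fun n => proj1 (cR n)).
have p0c n : p0 `<=` c n by rewrite -c0; exact: cle.
exists (\bigcup_n c n); split.
- by move=> x p0x; exists 0 => //; exact: p0c.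
- by move=> n; have [_ [x Qx cx]] := cR n; exists x => //; exists n.+1.
- move=> V u uF; have /choice[N NP] : forall i, exists n, c n (u i).
    by move=> i; have [n _ cn] := uF i; exists n.
  exists (c (\max_i N i)); split => //; first by move=> x cx; exists (\max_i N i).
  by move=> i; apply: cle (NP i); exact: (leq_bigmax i).
Qed.

(** * Types, back-and-forth, and orbits *)

(** The finiteness that categoricity provides. Representatives are listed, rather
    than definable sets counted, so that a minimal one can be found by induction. *)
Definition finitely_many_formulas (s : signature) (D : Type) (G : structure s D)
    (V : Type) :=
  exists (n : nat) (chi : 'I_n -> formula s V),
    forall phi, exists i, forall v, holds G v phi <-> holds G v (chi i).

(** The substitute for compactness in all extension steps: a type, or a
    primitive positive type, is isolated by one of its members. *)
Lemma least_formula (s : signature) (D : Type) (G : structure s D) (V : Type)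
    (Phi : set (formula s V)) :
  finitely_many_formulas G V -> Phi !=set0 ->
  (forall phi psi, Phi phi -> Phi psi ->
     exists2 theta, Phi theta & forall v, holds G v theta -> holds G v phi /\ holds G v psi) ->
  exists2 chi, Phi chi & forall phi, Phi phi -> forall v, holds G v chi -> holds G v phi.
Proof.
move=> [n [chi chiP]] [phi0 Phi0] conjP.
suff /(_ n)[theta thetaP thetaleq] : forall m, exists2 theta, Phi theta &
    forall i : 'I_n, i < m ->
      (exists2 phi, Phi phi & forall v, holds G v phi <-> holds G v (chi i)) ->
      forall v, holds G v theta -> holds G v (chi i).
  exists theta => // phi Pphi v hv; have [i iP] := chiP phi.
  by apply/iP; apply: thetaleq hv => //; exists phi.
elim=> [|m [theta thetaP IH]]; first by exists phi0.
have [mn|] := ltnP m n; last first.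
  move=> nm; exists theta => // i _; apply: IH; exact: leq_trans (ltn_ord i) nm.
have [[phi Pphi phiP]|no] := pselect (exists2 phi, Phi phi &
    forall v, holds G v phi <-> holds G v (chi (Ordinal mn))); last first.
  exists theta => // i; rewrite ltnS leq_eqVlt => /orP[/eqP im ex|]; last exact: IH.
  by case: no; suff -> : Ordinal mn = i by []; exact/val_inj.
have [rho Prho rhoP] := conjP _ _ Pphi thetaP.
exists rho => // i; rewrite ltnS leq_eqVlt => /orP[/eqP im ex|im ex] v /rhoP[h1 h2].
  have -> : i = Ordinal mn by exact/val_inj.
  exact/phiP.
exact: (IH i).
Qed.

Definition isomorphism (s : signature) (D E : Type) (G : structure s D)
    (M : structure s E) (h : D -> E) :=
  exists h' : E -> D,
    [/\ cancel h h', cancel h' h, homomorphism G M h & homomorphism M G h'].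

Lemma isomorphism_comp (s : signature) (D E F : Type) (G : structure s D)
    (M : structure s E) (N : structure s F) (g : D -> E) (h : E -> F) :
  isomorphism G M g -> isomorphism M N h -> isomorphism G N (h \o g).
Proof.
move=> [g' [gK g'K [gr gf] [gr' gf']]] [h' [hK h'K [hr hf] [hr' hf']]].
exists (g' \o h'); split; try by apply: can_comp.
- by split=> [r a /gr/hr //|f a /=]; rewrite gf hf.
- by split=> [r a /hr'/gr' //|f a /=]; rewrite hf' gf'.
Qed.

Lemma teval_hom (s : signature) (D E : Type) (G : structure s D)
    (M : structure s E) (h : D -> E) (V : Type) (v : V -> D) (t : term s V) :
  homomorphism G M h -> h (teval G v t) = teval M (h \o v) t.
Proof.
move=> [_ hf]; elim: t => //= f ts IH.
by rewrite hf; congr funI; apply/funext => i /=.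
Qed.

Lemma isomorphism_holds (s : signature) (D E : Type) (G : structure s D)
    (M : structure s E) (h : D -> E) (V : Type) (v : V -> D) (phi : formula s V) :
  isomorphism G M h -> holds M (h \o v) phi = holds G v phi.
Proof.
move=> [h' [hK h'K hom hom']].
have tK W (w : W -> D) t : teval M (h \o w) t = h (teval G w t).
  by rewrite (teval_hom _ _ hom).
elim: phi v => /= {V} //.
- move=> V t u v; rewrite !tK; apply/propext; split => [/(can_inj hK)|->] //.
- move=> V r ts v; have -> : (fun i => teval M (h \o v) (ts i)) = h \o (fun i => teval G v (ts i)).
    by apply/funext => i; rewrite tK.
   apply/propext; split; last by case: hom => + _; apply.
  case: hom' => + _ => /[apply]; congr (relI G _).
  by apply/funext => i /=; rewrite hK.
- by move=> V phi IH v; rewrite IH.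
- by move=> V phi IH psi IH' v; rewrite IH IH'.
- move=> V phi IH v.
  have oappE x : oapp (h \o v) (h x) = h \o oapp v x by apply/funext => -[].
  apply/propext; split=> [[y]|[x px]].
    by rewrite -[y]h'K oappE IH; exists (h' y).
  by exists (h x); rewrite oappE IH.
Qed.

Definition same_type (s : signature) (D E : Type) (G : structure s D)
    (M : structure s E) (V : Type) (v : V -> D) (w : V -> E) :=
  forall phi : formula s V, holds G v phi <-> holds M w phi.

Lemma same_typeW (s : signature) (D E : Type) (G : structure s D)
    (M : structure s E) (V : Type) (v : V -> D) (w : V -> E) :
  (forall phi : formula s V, holds G v phi -> holds M w phi) -> same_type G M v w.
Proof.
move=> H phi; split=> [|h]; first exact: H.
by apply: contrapT => nh; apply: (H (FNot phi)).
Qed.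

(** The pairs are indexed by a finite type, which also serves as the set of
    variables of the formulas that are compared. *)
Definition partial_elementary (s : signature) (D E : Type) (G : structure s D)
    (M : structure s E) (p : set (D * E)) :=
  exists (V : finType) (v : V -> D) (w : V -> E),
    same_type G M v w /\ p = [set x | exists i, x = (v i, w i)].

Lemma partial_elementary_same_type (s : signature) (D E : Type)
    (G : structure s D) (M : structure s E) (p : set (D * E))
    (V : Type) (u : V -> D * E) :
  partial_elementary G M p -> (forall x, p (u x)) ->
  same_type G M (fst \o u) (snd \o u).
Proof.
move=> [W [v [w [vw ->]]]] /choice[f fP] phi.
have -> : fst \o u = v \o f by apply/funext => x /=; rewrite fP.
have -> : snd \o u = w \o f by apply/funext => x /=; rewrite fP.
by have := vw (rename f phi); rewrite !holds_rename.
Qed.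

(** Since types over [option V] are isolated in [G], the existence of a
    realization, and that the isolating formula decides all others, are
    expressed by single formulas over [V]. *)
Lemma same_type_forth (s : signature) (D E : Type) (G : structure s D)
    (M : structure s E) (V : finType) (v : V -> D) (w : V -> E) (a : D) :
  finitely_many_formulas G (option V) -> same_type G M v w ->
  exists b, same_type G M (oapp v a) (oapp w b).
Proof.
move=> fin vw.
have [||chi chiP chi_min] := @least_formula _ _ G _ [set phi | holds G (oapp v a) phi] fin.
- by exists (FNot FFalse) => /=.
- by move=> phi psi hphi hpsi; exists (FAnd phi psi).
have /vw/=[b bP] : holds G v (FEx chi) by exists a.
exists b; apply: same_typeW => phi hphi.
have /vw/holds_FAll/(_ b)/holds_FImp : holds G v (FAll (FImp chi phi)).
  by apply/holds_FAll => x; apply/holds_FImp; exact: chi_min.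
exact.
Qed.

Lemma same_type_back (s : signature) (D E : Type) (G : structure s D)
    (M : structure s E) (V : finType) (v : V -> D) (w : V -> E) (b : E) :
  finitely_many_formulas G (option V) -> same_type G M v w ->
  exists a, same_type G M (oapp v a) (oapp w b).
Proof.
move=> fin vw.
have [||chi chiP chi_min] := @least_formula _ _ G _ [set phi | holds M (oapp w b) phi] fin.
- by exists (FNot FFalse) => /=.
- by move=> phi psi hphi hpsi; exists (FAnd phi psi).
have /vw/=[a aP] : holds M w (FEx chi) by exists b.
exists a => phi; split=> [|hphi]; last exact: (chi_min phi).
by apply: contraPP => nh; exact: (chi_min (FNot phi)).
Qed.

Lemma back_and_forth (s : signature) (D E : Type) (G : structure s D)
    (M : structure s E) (V : finType) (v : V -> D) (w : V -> E) :
  enumerable D -> enumerable E ->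
  (forall V : finType, finitely_many_formulas G V) -> same_type G M v w ->
  exists2 h, isomorphism G M h & h \o v = w.
Proof.
move=> [eD eDP] [eE eEP] fin vw.
pose P := partial_elementary G M.
have step_opt (V' : finType) (v' : V' -> D) (w' : V' -> E) a b :
    same_type G M (oapp v' a) (oapp w' b) ->
    P ([set x | exists i, x = (v' i, w' i)] `|` [set (a, b)]).
  move=> ab; exists (option V'), (oapp v' a), (oapp w' b); split=> //.
  apply/seteqP; split=> x /=.
    by move=> [[i ->]|->]; [exists (Some i)|exists None].
  by move=> [[i|] ->]; [left; exists i|right].
(* Even steps serve the domain, odd steps the range. *)
have [|n p [V' [v' [w' [vw' ->]]]]|F [p0F FQ Ffin]] := @generic_union _ P
    (fun n x => if odd n then x.2 = eE n./2 else x.1 = eD n./2)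
    [set x | exists i, x = (v i, w i)].
- by exists V, v, w.
- case: (odd n).
    have [a /step_opt] := same_type_back (eE n./2) (fin _) vw'.
    by exists (a, eE n./2).
  have [b /step_opt] := same_type_forth (eD n./2) (fin _) vw'.
  by exists (eD n./2, b).
have Ftype (W : finType) (u : W -> D * E) :
    (forall i, F (u i)) -> same_type G M (fst \o u) (snd \o u).
  by move=> /Ffin[p [Pp _ _ pu]]; exact: partial_elementary_same_type pu.
have Ftot1 a : exists b, F (a, b).
  have [n <-] := eDP a; have [[a' b] /=] := FQ n.*2.
  by rewrite odd_double doubleK => ->; exists b.
have Ftot2 b : exists a, F (a, b).
  have [n <-] := eEP b; have [[a b'] /=] := FQ n.*2.+1.
  by rewrite odd_double /= uphalf_double => ->; exists a.
have Feq x y : F x -> F y -> x.1 = y.1 <-> x.2 = y.2.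
  move=> Fx Fy; have /Ftype := fun i : bool => (if i as b return F (if b then x else y)
    then Fx else Fy).
  by move=> /(_ (FEq (Var true) (Var false))).
have [h hF] := choice Ftot1; have [h' hF'] := choice Ftot2.
have hE a b : F (a, b) -> h a = b by move=> /(Feq _ _ (hF a)) /=[+ _]; exact.
have hE' a b : F (a, b) -> h' b = a by move=> /(Feq _ _ (hF' b)) /=[_ +]; exact.
exists h; last by apply/funext => i /=; apply: hE; apply: p0F; exists i.
exists h'; split.
- by move=> a; apply: hE'.
- by move=> b; apply: hE.
- split=> [r a|f a].
    have /Ftype/(_ (FRel r Var))[+ _] : forall i, F (a i, (h \o a) i) by move=> i; exact: hF.
    exact.
  apply: hE; pose u i := (oapp a (funI G a) i, oapp (h \o a) (h (funI G a)) i).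
  have /Ftype/(_ (FEq (Var None) (App f (Var \o Some))))/=[+ _] : forall i, F (u i).
    by move=> [i|]; exact: hF.
  by move=> <- //; exact: hF.
- split=> [r a|f a].
    have /Ftype/(_ (FRel r Var))[_ +] : forall i, F ((h' \o a) i, a i) by move=> i; exact: hF'.
    exact.
  pose u i := (oapp (h' \o a) (h' (funI M a)) i, oapp a (funI M a) i).
  have /Ftype/(_ (FEq (Var None) (App f (Var \o Some))))/=[_ +] : forall i, F (u i).
    by move=> [i|]; exact: hF'.
  exact.
Qed.

Definition oligomorphic (s : signature) (D : Type) (G : structure s D) :=
  forall V : finType, exists (n : nat) (l : 'I_n -> V -> D),
    forall v, exists i, exists2 alpha, isomorphism G G alpha & alpha \o l i = v.

(** A formula is determined by the set of tuples [l i] that satisfy it. *)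
Lemma finitely_many_types_formulas (s : signature) (D : Type) (G : structure s D)
    (V : Type) (n : nat) (l : 'I_n -> V -> D) :
  (forall v, exists i, same_type G G (l i) v) -> finitely_many_formulas G V.
Proof.
move=> lP.
pose trace (phi : formula s V) := [set i | `[< holds G (l i) phi >]]%SET.
have /choice[chi chiP] := fun j : 'I_#|{set 'I_n}| =>
  exists_member_if_any [set phi | trace phi = enum_val j] FFalse.
exists #|{set 'I_n}|, chi => phi; exists (enum_rank (trace phi)) => v.
have := chiP (enum_rank (trace phi)) phi; rewrite /= enum_rankK => /(_ erefl) tr.
have [i iv] := lP v; have [iphi1 iphi2] := iv phi.
have [ichi1 ichi2] := iv (chi (enum_rank (trace phi))).
have : (i \in trace (chi (enum_rank (trace phi)))) = (i \in trace phi) by rewrite tr.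
rewrite !inE => E; split.
  by move=> /iphi2/asboolP; rewrite -E => /asboolP/ichi1.
by move=> /ichi2/asboolP; rewrite E => /asboolP/iphi1.
Qed.

Lemma oligomorphic_formulas (s : signature) (D : Type) (G : structure s D)
    (V : finType) :
  oligomorphic G -> finitely_many_formulas G V.
Proof.
move=> /(_ V)[n [l lP]]; apply: (finitely_many_types_formulas (l := l)) => v.
by have [i [alpha aut <-]] := lP v; exists i => phi; rewrite (isomorphism_holds _ _ aut).
Qed.

(** Tuples of the same type lie in the same orbit by back-and-forth, and types
    are isolated by one of finitely many formulas. *)
Lemma formulas_oligomorphic (s : signature) (D : pointedType) (G : structure s D) :
  enumerable D -> (forall V : finType, finitely_many_formulas G V) -> oligomorphic G.
Proof.
move=> De fin V; have [n [chi chiP]] := fin V.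
have /choice[l lP] := fun i =>
  exists_member_if_any [set v | holds G v (chi i)] (fun=> point).
exists n, l => v.
have [||phi phiv phi_min] := @least_formula _ _ G _ [set phi | holds G v phi] (fin V).
- by exists (FNot FFalse) => /=.
- by move=> phi psi hphi hpsi; exists (FAnd phi psi).
have [i iP] := chiP phi; exists i.
apply: back_and_forth => //.
suff vw : same_type G G v (l i) by move=> psi; apply: iff_sym; exact: vw.
by apply: same_typeW => psi /phi_min; apply; apply/iP/(lP i v)/iP.
Qed.

Lemma finite_oligomorphic (s : signature) (D : pointedType) (G : structure s D) :
  finite_set [set: D] -> oligomorphic G.
Proof.
move=> /finite_seqP[d dP] V.
have dD x : x \in d by have : [set` d] x by rewrite -dP.
exists #|{ffun V -> 'I_(size d)}|,
  (fun (j : 'I_#|{ffun V -> 'I_(size d)}|) x => nth point d ((enum_val j : {ffun V -> 'I_(size d)}) x)) => v.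
have vd x : index (v x) d < size d by rewrite index_mem.
exists (enum_rank [ffun x => Ordinal (vd x)]), id.
  by exists id; split=> //; split.
by apply/funext => x /=; rewrite enum_rankK ffunE nth_index.
Qed.

(** In an orbit that meets [A], a member of [A] replaces the representative. *)
Lemma orbit_representatives (s : signature) (D : Type) (G : structure s D)
    (V : finType) (A : set (V -> D)) :
  oligomorphic G -> A !=set0 ->
  exists (n : nat) (l : 'I_n.+1 -> V -> D), (forall i, A (l i)) /\
    forall v, A v -> exists i, exists2 alpha, isomorphism G G alpha & alpha \o l i = v.
Proof.
move=> olig [a Aa]; have [[|n] [l lP]] := olig V; first by have [[]] := lP a.
have /choice[k kP] : forall i, exists w, A w /\ forall v, A v ->
    (exists2 alpha, isomorphism G G alpha & alpha \o l i = v) ->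
    exists2 alpha, isomorphism G G alpha & alpha \o l i = w.
  move=> i; have [[w [Aw orb]]|no] := pselect (exists w, A w /\
      exists2 alpha, isomorphism G G alpha & alpha \o l i = w).
    by exists w; split.
  by exists a; split=> // v Av orb; case: no; exists v.
exists n, k; split=> [i|v Av]; first by have [] := kP i.
have [i orb] := lP v; exists i; have [_ /(_ v Av orb)] := kP i.
have [alpha aut <-] := orb => -[beta [beta' [bK b'K bh bh']] <-].
exists (alpha \o beta'); last by apply/funext => x /=; rewrite bK.
by apply: isomorphism_comp aut; exists beta.
Qed.

(** * Countable elementary substructures *)

(** The Tarski-Vaught test for the set of values of a sequence; every tuple of
    such values is [c] composed with a renaming of variables, so that formulas
    over [nat] suffice. *)
Definition tarski_vaught (s : signature) (X : Type) (G : structure s X)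
    (c : nat -> X) :=
  forall psi : formula s (option nat), (exists y, holds G (oapp c y) psi) ->
    exists m, holds G (oapp c (c m)) psi.

(** [P n c] is a condition on the first [n.+1] values of [c]. A witness is
    needed for one formula at a time, and a formula sees finitely many values
    only. *)
Lemma generic_tarski_vaught (s : signature) (X : Type) (G : structure s X)
    (P : nat -> (nat -> X) -> Prop) (n0 : nat) (c0 : nat -> X) :
  countable_signature s -> P n0 c0 ->
  (forall n c (psi : formula s (option 'I_n.+1)), P n c ->
     (exists y, holds G (oapp (c \o val) y) psi) ->
     exists2 y, holds G (oapp (c \o val) y) psi &
       P n.+1 (fun i => if i <= n then c i else y)) ->
  exists c, [/\ forall i, i <= n0 -> c i = c0 i, tarski_vaught G c &
    forall N, exists n c', [/\ N <= n, P n c' & forall i, i <= n -> c i = c' i]].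
Proof.
move=> hs P0 ext.
pose le (t t' : nat * (nat -> X)) :=
  t.1 <= t'.1 /\ forall i, i <= t.1 -> t.2 i = t'.2 i.
have le_trans t t' t'' : le t t' -> le t' t'' -> le t t''.
  move=> [l1 e1] [l2 e2]; split=> [|i il]; first exact: leq_trans l2.
  by rewrite e1 // e2 // (leq_trans il).
have ext_le n c y : le (n, c) (n.+1, fun i => if i <= n then c i else y).
  by split=> //= i ->.
have pad N t : P t.1 t.2 -> exists t', [/\ P t'.1 t'.2, le t t' & N <= t'.1].
  move=> Pt; elim: N => [|N [[n c] /= [Pn lt Nn]]]; first by exists t.
  have [|y _ Py] := ext n c (FNot FFalse) Pn; first by exists (c 0) => /=.
  by exists (n.+1, fun i => if i <= n then c i else y); split=> //; apply: le_trans lt _.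
have [e eP] : enumerable (formula s (option nat)).
  by apply: (enumerable_countable FFalse); apply: countable_formula.
have [|ch [ch0 chP chR]] := @dependent_chain _ (fun t : nat * (nat -> X) => P t.1 t.2)
  (fun k t t' => [/\ le t t', k <= t'.1 &
     forall c, (forall i, i <= t'.1 -> c i = t'.2 i) ->
       (exists y, holds G (oapp c y) (e k)) ->
       exists m, holds G (oapp c (c m)) (e k)]) (n0, c0) P0.
  move=> k t /= Pt.
  (* Once [n] exceeds [N], the values beyond [n] do not affect [e k]. *)
  have [N NP] := formula_support (e k) (oapp S 0).
  have [[n c] /= [Pn let' Nn]] := pad (maxn N k) t Pt.
  move: Nn; rewrite geq_max => /andP[Nn kn].
  have eqN (c1 c2 : nat -> X) y : (forall i, i <= n -> c1 i = c2 i) ->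
      holds G (oapp c1 y) (e k) = holds G (oapp c2 y) (e k).
    move=> c12; apply: NP => -[i /= iN|] //=.
    by apply: c12; apply: leq_trans Nn; exact: ltnW (ltnW iN).
  pose psi := rename (omap (@inord n)) (e k).
  have psiE y : holds G (oapp (c \o val) y) psi = holds G (oapp c y) (e k).
    rewrite holds_rename oapp_omap; apply: eqN => i il /=.
    by rewrite inordK.
  have [ex|no] := pselect (exists y, holds G (oapp c y) (e k)); last first.
    exists (n, c) => //; split=> //= c' c'c [y yP]; case: no.
    by exists y; rewrite -(eqN c').
  have [|y yP Py] := ext n c psi Pn; first by have [y yP] := ex; exists y; rewrite psiE.
  exists (n.+1, fun i => if i <= n then c i else y) => //; split.
  - exact: le_trans let' _.
  - exact: leqW.
  - move=> c' c'c _; exists n.+1; rewrite (c'c n.+1) //= ltnn.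
    rewrite (eqN _ c) -?psiE // => i il.
    by rewrite (c'c i) /= ?il // leqW.
have chle m n : m <= n -> le (ch m) (ch n).
  move=> /subnKC <-; elim: (n - m) => [|k IH]; first by rewrite addn0.
  by rewrite addnS; apply: le_trans IH _; have [] := chR (m + k).
have chsize n : n <= (ch n.+1).1 by have [] := chR n.
pose c i := (ch i.+1).2 i.
have cE n i : i <= (ch n).1 -> c i = (ch n).2 i.
  move=> il; rewrite /c; have [in1|/ltnW ni] := leqP i.+1 n.
    by have [_ ->] := chle _ _ in1.
  by have [_ <-] := chle _ _ ni.
exists c; split=> [i il|psi ex|N].
- by rewrite (cE 0) ch0.
- have [k eE] := eP psi; rewrite -eE in ex *.
  by have [_ _] := chR k; apply=> // i il; exact: cE.
- by exists (ch N.+1).1, (ch N.+1).2; split=> // i; exact: cE.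
Qed.

Lemma infinite_injective (T U : Type) (f : T -> U) :
  injective f -> infinite_set [set: T] -> infinite_set [set: U].
Proof.
move=> f_inj /infiniteP natT; apply/infiniteP.
apply: (card_le_trans natT); apply: (@card_le_trans _ _ _ (range f)).
  by rewrite (card_le_eqr (inj_card_eq _)) //; move=> x y _ _; exact: f_inj.
exact: subset_card_le.
Qed.

Lemma finite_range_bound (X : Type) (c : nat -> X) :
  finite_set (range c) -> exists N, forall m, exists2 i, i < N & c i = c m.
Proof.
move=> /(@finite_seqP {classic X})[l lP].
have /choice[f fP] := fun x => exists_member_if_any [set i | c i = x] 0.
exists (\max_(x <- l) f x).+1 => m; exists (f (c m)); last exact: (fP (c m) m erefl).
rewrite ltnS; apply: leq_bigmax_seq => //.
by have : [set` l] (c m) by rewrite -lP; exists m.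
Qed.

Fixpoint distinct_from (s : signature) (N : nat) : formula s (option nat) :=
  if N is n.+1 then FAnd (FNot (FEq (Var None) (Var (Some n)))) (distinct_from s n)
  else FNot FFalse.

Lemma holds_distinct_from (s : signature) (X : Type) (G : structure s X)
    (c : nat -> X) (y : X) (N : nat) :
  holds G (oapp c y) (distinct_from s N) <-> forall i, i < N -> y <> c i.
Proof.
elim: N => [|N IH] /=; first by split=> // _ [].
split=> [[yN /IH yi] i|H].
  by rewrite ltnS leq_eqVlt => /orP[/eqP -> //|/yi].
by split; [exact: H|apply/IH => i iN; apply: H; exact: ltnW].
Qed.

Lemma tarski_vaught_infinite (s : signature) (X : Type) (G : structure s X)
    (c : nat -> X) :
  infinite_set [set: X] -> tarski_vaught G c -> infinite_set (range c).
Proof.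
move=> Xinf tv /finite_range_bound[N NP].
have [y yP] : exists y, forall i, i < N -> y <> c i.
  apply: contrapT => no; apply: Xinf.
  apply: (@sub_finite_set _ _ (c @` `I_N)); last exact/finite_image/finite_II.
  move=> y _; apply: contrapT => yc; apply: no; exists y => i iN yi.
  by apply: yc; exists i.
have [|m] := tv (distinct_from s N); first by exists y; apply/holds_distinct_from.
move=> /holds_distinct_from H; have [i iN im] := NP m.
by apply: (H i).
Qed.

(** The values of [c] form a countable elementary substructure of [N], thus a
    model of the theory of [G], and categoricity makes it a copy of [G]. *)
Lemma omega_categorical_embedding (s : signature) (D X : Type) (G : structure s D)
    (N : structure s X) (c : nat -> X) :
  omega_categorical G -> models_theory G N -> infinite_set [set: X] ->
  tarski_vaught N c ->
  exists2 g : D -> X, range g = range c &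
    forall (V : Type) (v : V -> D) (phi : formula s V),
      holds N (g \o v) phi = holds G v phi.
Proof.
move=> [Dnat hs cat] GN Xinf tv.
pose E := {x : X | exists i, c i = x}.
have idx V (v : V -> E) : exists u : V -> nat, forall x, sval (v x) = c (u x).
  have /choice[u uP] : forall x, exists i, c i = sval (v x).
    by move=> x; case: (v x).
  by exists u.
have /choice[fE fEP] : forall fa : {f : funsym s & 'I_(farity f) -> E},
    exists y : E, sval y = funI N (fun i => sval (projT2 fa i)).
  move=> [f a] /=; have [u uP] := idx _ a.
  have [|m /= mP] := tv (FEq (Var None) (App f (fun i => Var (Some (u i))))).
    by exists (funI N (fun i => c (u i))).
  exists (exist _ (c m) (ex_intro _ m erefl)) => /=; rewrite mP.
  by congr funI; apply/funext => i.
pose M : structure s E := {|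
  relI := fun r a => relI N (fun i => sval (a i));
  funI := fun f a => fE (existT _ f a) |}.
have tM V (v : V -> E) t : sval (teval M v t) = teval N (fun x => sval (v x)) t.
  elim: t => //= f ts IH; rewrite fEP /=.
  by congr funI; apply/funext => i; rewrite IH.
have svalI : injective (@sval _ (fun x => exists i, c i = x)).
  by move=> [x px] [y py] /= xy; exact: eq_exist.
have elem V (v : V -> E) phi : holds N (fun x => sval (v x)) phi = holds M v phi.
  elim: phi v => /= {V} //.
  - move=> V t u v; rewrite -!tM; apply/propext; split=> [/svalI|->] //.
  - move=> V r ts v; congr (relI N _).
    by apply/funext => i; rewrite tM.
  - by move=> V phi IH v; rewrite IH.
  - by move=> V phi IH psi IH' v; rewrite IH IH'.
  - move=> V phi IH v.
    have oE y : oapp (fun x => sval (v x)) (sval y) = fun x => sval (oapp v y x).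
      by apply/funext => -[].
    apply/propext; split=> [[y yP]|[y]]; last by rewrite -IH -oE; exists (sval y).
    have [u uP] := idx _ v.
    have uE z : oapp (fun x => sval (v x)) z = oapp c z \o omap u.
      by apply/funext => -[x|] //=.
    have [|m] := tv (rename (omap u) phi); first by exists y; rewrite holds_rename -uE.
    rewrite holds_rename -uE => mP.
    by exists (exist _ (c m) (ex_intro _ m erefl)); rewrite -IH -oE.
have rangeE : range c = range (@sval _ (fun x => exists i, c i = x)).
  apply/seteqP; split=> x [y _ <-]; last by case: y => z /= [i <-]; exists i.
  by exists (exist _ (c y) (ex_intro _ y erefl)).
have Enat : ([set: E] #= [set: nat])%card.
  rewrite card_eq_le; apply/andP; split.
    rewrite -/(countable _).
    apply/countable_injP; have [u uP] := idx _ (@id E); exists u => x y _ _ xy.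
    by apply: svalI; rewrite uP xy -uP.
  apply/infiniteP => Efin; apply: (tarski_vaught_infinite Xinf tv).
  by rewrite rangeE; exact: finite_image.
have GM : models_theory G M.
  move=> phi /GN; rewrite -elem; congr holds.
  by apply/funext => -[].
have [h [h' [hK h'K hh hh']]] := cat E M Enat GM.
have iso : isomorphism G M h by exists h'.
exists (fun x => sval (h x)).
- rewrite rangeE; apply/seteqP; split=> x [y _ <-]; first by exists (h y).
  by exists (h' y); rewrite // h'K.
- move=> V v phi; rewrite -(isomorphism_holds v phi iso).
  exact: (elem V (h \o v)).
Qed.

(** * Categoricity bounds the number of formulas *)

(** In the ultrapower of [G] along a nonprincipal ultrafilter on [nat], a
    sequence of tuples whose [n]-th member satisfies [psi n] is a tuple that
    satisfies each [psi n]. *)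
Lemma ultrapower_realizes (s : signature) (D : Type) (G : structure s D)
    (V : Type) (psi : nat -> formula s V) :
  infinite_set [set: D] ->
  (forall n v, holds G v (psi n.+1) -> holds G v (psi n)) ->
  (forall n, exists v, holds G v (psi n)) ->
  exists (X : Type) (N : structure s X) (w : V -> X),
    [/\ infinite_set [set: X], models_theory G N & forall n, holds N w (psi n)].
Proof.
move=> Dinf psi_dec psi_sat.
have [U [UU Uoo]] := ultraFilterLemma eventually_filter.
have UF : ProperFilter U := @ultra_proper _ U UU.
have UF0 : Filter U := @filter_filter _ U UF.
have UE (A B : set nat) : U [set k | A k <-> B k] -> U A -> U B.
  by move=> UAB UA; apply: filterS (filterI UAB UA) => k [/= AB /AB].
pose cls (f : nat -> D) : set (nat -> D) := [set g | U [set k | f k = g k]].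
pose X := {A | exists f, A = cls f}.
pose cl f : X := exist _ (cls f) (ex_intro _ f erefl).
have /choice[rep repK] : forall x : X, exists f, cl f = x.
  by move=> [A [f Af]]; exists f; exact: eq_exist.
have clP f g : cl f = cl g <-> U [set k | f k = g k].
  split=> [[E]|fg].
    by rewrite -[U _]/(cls f g) E; apply: filterS filterT => k _.
  apply: eq_exist; apply/seteqP; split=> h fh; rewrite /cls /= in fh *.
    by apply: filterS (filterI fg fh) => k [/= -> ->].
  by apply: filterS (filterI fg fh) => k [/= -> ->].
have repP f : U [set k | rep (cl f) k = f k] by apply/clP; rewrite repK.
pose N : structure s X := {|
  relI := fun r a => U [set k | relI G (r := r) (fun i => rep (a i) k)];
  funI := fun f a => cl (fun k => funI G (f := f) (fun i => rep (a i) k)) |}.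
have Nt W (w : W -> nat -> D) t :
    teval N (cl \o w) t = cl (fun k => teval G (w^~ k) t).
  elim: t => //= f ts IH; apply/clP.
  apply: filterS (filter_forall UF0 (fun i => repP (fun k => teval G (w^~ k) (ts i)))).
  by move=> k H /=; congr funI; apply/funext => i; rewrite IH H.
have los W (w : W -> nat -> D) phi :
    holds N (cl \o w) phi <-> U [set k | holds G (w^~ k) phi].
  elim: phi w => /= {}W.
  - by move=> w; split=> // /filter_not_empty.
  - by move=> t u w; rewrite !Nt.
  - move=> r ts w.
    have H := filter_forall UF0 (fun i => repP (fun k => teval G (w^~ k) (ts i))).
    have E k : (forall i, rep (cl (fun k => teval G (w^~ k) (ts i))) k
           = teval G (w^~ k) (ts i)) ->
        (fun i => rep (teval N (cl \o w) (ts i)) k) = fun i => teval G (w^~ k) (ts i).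
      by move=> Hk; apply/funext => i; rewrite Nt Hk.
    by split; apply: UE; apply: filterS H => k /E /= ->.
  - move=> phi IH w; split=> [nphi|Unphi /IH Uphi]; last first.
      by have /filter_ex[k []] := @filterI _ U UF0 _ _ Unphi Uphi.
    by have [/IH//|] := in_ultra_setVsetC [set k | holds G (w^~ k) phi] UU.
  - move=> phi IH psi' IH' w; split=> [[/IH H /IH' H']|H].
      exact: filterI H H'.
    by split; [apply/IH|apply/IH']; apply: filterS H => k [].
  - move=> phi IH w.
    have oE (f : nat -> D) : oapp (cl \o w) (cl f) = cl \o oapp w f.
      by apply/funext => -[].
    have oE' (f : nat -> D) k : (fun x => oapp w f x k) = oapp (w^~ k) (f k).
      by apply/funext => -[].
    split=> [[x]|].
      rewrite -[x]repK oE => /IH; apply: filterS => k /=.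
      by rewrite oE'; exists (rep x k).
    move=> H; have [d0 _] := infinite_setN0 Dinf.
    have /choice[f fP] := fun k =>
      exists_member_if_any [set x | holds G (oapp (w^~ k) x) phi] d0.
    exists (cl f); rewrite oE; apply/IH; apply: filterS H => k [x hx] /=.
    by rewrite oE'; exact: fP hx.
have /choice[v vP] := psi_sat.
have psi_le m n a : m <= n -> holds G a (psi n) -> holds G a (psi m).
  move=> /subnKC <-; elim: (n - m) => [|k IH]; first by rewrite addn0.
  by rewrite addnS => /psi_dec.
exists X, N, (cl \o fun x k => v k x); split.
- apply: (infinite_injective (f := fun d => cl (fun=> d))) Dinf => d d' /clP.
  by move=> /filter_ex[].
- move=> phi hphi; rewrite (_ : of_void X = cl \o of_void _); last by apply/funext=> -[].
  apply/los; apply: filterS filterT => k _ /=.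
  by rewrite (_ : (fun x => _) = of_void D) //; apply/funext => -[].
- move=> n; apply/los; apply: Uoo; exists n => // k /= nk.
  exact: psi_le nk (vP k).
Qed.

Section Omega_categorical.
Variables (s : signature) (D : Type) (G : structure s D).
Hypothesis cat : omega_categorical G.

Let infD : infinite_set [set: D].
Proof.
by case: cat => Dnat _ _; apply/infiniteP; move: Dnat; rewrite card_eq_le => /andP[].
Qed.

Let enumD : enumerable D.
Proof.
have [d _] := infinite_setN0 infD.
by apply: (enumerable_countable d); case: cat; rewrite card_eq_le => /andP[].
Qed.

(** The realization in the ultrapower lies in a countable elementary
    substructure, which is a copy of [G]. *)
Lemma omega_categorical_realizes (V : finType) (psi : nat -> formula s V) :
  (forall n v, holds G v (psi n.+1) -> holds G v (psi n)) ->
  (forall n, exists v, holds G v (psi n)) ->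
  exists v, forall n, holds G v (psi n).
Proof.
move=> psi_dec psi_sat.
have [X [N [w [Xinf GN wP]]]] := ultrapower_realizes infD psi_dec psi_sat.
have [x0 _] := infinite_setN0 Xinf.
have hs : countable_signature s by case: cat.
pose c0 i := oapp (w \o enum_val) x0 (insub i : option 'I_#|V|).
have [//|n c psi' _ [y yP]|c [cc0 tv _]] :=
  @generic_tarski_vaught _ _ N (fun _ _ => True) #|V| c0 hs; first by exists y.
have [g grange gE] := omega_categorical_embedding cat GN Xinf tv.
have /choice[v vP] : forall x, exists d, g d = w x.
  move=> x; suff [d _ <-] : range g (w x) by exists d.
  rewrite grange; exists (enum_rank x) => //; rewrite cc0 /c0; last exact: ltnW.
  by rewrite valK /= enum_rankK.
exists v => n; rewrite -gE (_ : g \o v = w) //; exact/funext.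
Qed.

Definition isolated (V : Type) (v : V -> D) :=
  exists2 chi, holds G v chi &
    forall phi, holds G v phi -> forall w, holds G w chi -> holds G w phi.

(** Otherwise one could avoid all countably many tuples one after the other,
    by a decreasing sequence of satisfiable formulas. *)
Lemma isolated_dense (V : finType) (phi : formula s V) :
  (exists v, holds G v phi) -> exists2 v, holds G v phi & isolated v.
Proof.
move=> ex; apply: contrapT => noiso.
have [a aP] := enumerable_ffun V enumD.
have [||psi [psi0 psiP psiR]] := @dependent_chain _ (fun psi =>
    (exists v, holds G v psi) /\ forall v, holds G v psi -> holds G v phi)
  (fun n psi psi' => (forall v, holds G v psi' -> holds G v psi) /\
    ~ holds G (a n) psi') phi.
- by split.
- move=> n psi [[v vpsi] psiphi].
  have [theta [vtheta [w [wpsi wtheta]]]] : exists theta, holds G v theta /\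
      exists w, holds G w psi /\ ~ holds G w theta.
    apply: contrapT => no; apply: noiso; exists v; first exact: psiphi.
    exists psi => // theta vtheta w wpsi; apply: contrapT => wtheta.
    by apply: no; exists theta; split=> //; exists w.
  have [atheta|atheta] := pselect (holds G (a n) theta).
    exists (FAnd psi (FNot theta)).
      by split=> [|u /= [/psiphi]] //; exists w.
    by split=> [u /= []|/= []].
  exists (FAnd psi theta); first by split=> [|u /= [/psiphi]] //; exists v.
  by split=> [u /= []|/= []].
have [||v vP] := @omega_categorical_realizes V psi.
- by move=> n v; have [+ _] := psiR n; apply.
- by move=> n; have [] := psiP n.
- by have [n nv] := aP v; have [_] := psiR n; apply; rewrite nv.
Qed.

Lemma isolated_reindex (V W : Type) (v : V -> D) (f : W -> V) (f' : V -> W) :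
  cancel f f' -> cancel f' f -> isolated v -> isolated (v \o f).
Proof.
move=> fK f'K [chi hchi chiP]; exists (rename f' chi).
  rewrite holds_rename (_ : (v \o f) \o f' = v) //.
  by apply/funext => x /=; rewrite f'K.
move=> phi; rewrite -holds_rename => /chiP H w; rewrite holds_rename => /H.
rewrite holds_rename (_ : (w \o f') \o f = w) //.
by apply/funext => x /=; rewrite fK.
Qed.

(** Some tuple [w] realizing the isolating formula of [v] has an extension that
    satisfies [psi] and is isolated by [rho]. Since [v] and [w] have the same
    type, [rho] is also realized over [v]. *)
Lemma isolated_extend (V : finType) (v : V -> D) (psi : formula s (option V)) :
  isolated v -> (exists y, holds G (oapp v y) psi) ->
  exists2 y, holds G (oapp v y) psi & isolated (oapp v y).
Proof.
move=> [chi hchi chiP] [y yP].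
have [|w /= [wchi wpsi] [rho wrho rhoP]] :=
    @isolated_dense _ (FAnd (rename Some chi) psi).
  by exists (oapp v y); split=> //=; rewrite holds_rename.
have wE : w = oapp (w \o Some) (w None) by apply/funext => -[].
have [z zrho] : holds G v (FEx rho).
  apply: contrapT => /(chiP (FNot (FEx rho))) /(_ (w \o Some)) /=.
  by rewrite -holds_rename => /(_ wchi); apply; exists (w None); rewrite -wE.
have same phi : holds G (oapp v z) phi -> holds G w phi.
  move=> zphi; apply: contrapT => wphi.
  exact: (rhoP (FNot phi) wphi _ zrho).
exists z; first exact: rhoP wpsi _ zrho.
by exists rho => // phi /same; exact: rhoP.
Qed.

(** Formulas bind one variable at a time; the semantic form hides the order in
    which the variables of the block are bound. *)
Lemma block_exists (V W : finType) (phi : formula s (V + W)) :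
  exists theta : formula s V, forall v,
    holds G v theta <-> exists w : W -> D, holds G (sum_rect _ v w) phi.
Proof.
suff block_ord n (U : Type) (rho : formula s (U + 'I_n)) :
    exists theta : formula s U, forall v,
      holds G v theta <-> exists w, holds G (sum_rect _ v w) rho.
  pose f (x : V + W) : V + 'I_#|W| :=
    match x with inl y => inl y | inr z => inr (enum_rank z) end.
  have [theta thetaP] := block_ord _ _ (rename f phi).
  exists theta => v; split=> [/thetaP[w]|[w hw]].
    rewrite holds_rename => hw; exists (w \o enum_rank); congr holds: hw.
    by apply/funext => -[].
  apply/thetaP; exists (w \o enum_val); rewrite holds_rename; congr holds: hw.
  by apply/funext => -[] //= x; rewrite enum_rankK.
elim: n U rho => [|n IH] U rho.
  pose f (x : U + 'I_0) : U :=
    match x with inl y => y | inr z => match notF (valP z) with end end.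
  have E v w : v \o f = sum_rect (fun=> D) v w.
    by apply/funext => -[//|[]].
  exists (rename f rho) => v; rewrite holds_rename; split=> [|[w]].
    pose w (z : 'I_0) : D := match notF (valP z) with end.
    by rewrite (E v w); exists w.
  by rewrite (E v w).
pose f (x : U + 'I_n.+1) : option U + 'I_n :=
  match x with
  | inl y => inl (Some y)
  | inr z => if unlift ord0 z is Some z' then inr z' else inl None
  end.
have [theta thetaP] := IH _ (rename f rho).
exists (FEx theta) => v; split=> [/= [y /thetaP[w]]|[w hw]].
  rewrite holds_rename => hw; exists (fun z => oapp w y (unlift ord0 z)).
  congr holds: hw; apply/funext => -[] //= z.
  by case: (unlift ord0 z).
exists (w ord0); apply/thetaP; exists (w \o lift ord0); rewrite holds_rename.
congr holds: hw; apply/funext => -[] //= z.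
by case: unliftP => [z' ->|->].
Qed.

(** Projecting a formula that isolates [v] isolates the tuples made of entries
    of [v]. *)
Lemma isolated_subtuple (V W : finType) (v : V -> D) (f : W -> V) :
  isolated v -> isolated (v \o f).
Proof.
move=> [chi hchi chiP].
have [eqs eqsP] : exists eqs : formula s (W + V), forall (w : W -> D) (u : V -> D),
    holds G (sum_rect _ w u) eqs <-> w = u \o f.
  have [eqs eqsP] : exists eqs : formula s (W + V), forall (w : W -> D) (u : V -> D),
      holds G (sum_rect _ w u) eqs <-> forall x, x \in enum W -> w x = u (f x).
    elim: (enum W) => [|x l [eqs eqsP]]; first by exists (FNot FFalse) => w u; split=> // _ [].
    exists (FAnd (FEq (Var (inl x)) (Var (inr (f x)))) eqs) => w u; split=> /=.
      by move=> [wu /eqsP H] y; rewrite inE => /orP[/eqP->|/H].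
    move=> H; split; first by apply: H; rewrite mem_head.
    by apply/eqsP => y yl; apply: H; rewrite inE yl orbT.
  exists eqs => w u; split=> [/eqsP wu|-> //].
    by apply/funext => x; apply: wu; rewrite mem_enum.
  exact/eqsP.
have [theta thetaP] := block_exists (FAnd (rename inr chi) eqs).
exists theta.
  apply/thetaP; exists v; split; last exact/eqsP.
  by rewrite holds_rename.
move=> phi; rewrite -holds_rename => /chiP H w /thetaP[u /= []].
rewrite holds_rename => uchi /eqsP ->.
by rewrite -holds_rename; exact: H.
Qed.

(** Some elementary substructure of [G] has isolated tuples only, and by
    categoricity it is a copy of [G]. *)
Lemma omega_categorical_atomic (V : finType) (v : V -> D) : isolated v.
Proof.
have hs : countable_signature s by case: cat.
have [|w _ isow] := @isolated_dense 'I_1 (FNot FFalse).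
  by have [d _] := infinite_setN0 infD; exists (fun=> d) => /=.
have [||c [_ tv cP]] := @generic_tarski_vaught _ _ G
  (fun n c => isolated (c \o val : 'I_n.+1 -> D)) 0 (fun=> w ord0) hs.
- by rewrite (_ : _ \o _ = w) //; apply/funext => i /=; rewrite ord1.
- move=> n c psi iso /(isolated_extend iso)[y ypsi yiso]; exists y => //.
  pose f (i : option 'I_n.+1) := oapp (lift ord_max) ord_max i.
  rewrite (_ : _ \o _ = oapp (c \o val) y \o unlift (@ord_max n.+1)).
    apply: (@isolated_reindex _ _ _ _ f) yiso.
      by move=> i; rewrite /f; case: unliftP.
    by move=> [i|]; rewrite /f /= ?liftK ?unlift_none.
  apply/funext => i /=; case: unliftP => [j ->|->] /=; last by rewrite ltnn.
  have -> : bump n.+1 j = j by rewrite /bump leqNgt ltn_ord.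
  by rewrite -ltnS ltn_ord.
have [g grange gE] := omega_categorical_embedding cat (fun _ => id) infD tv.
suff [chi hchi chiP] : isolated (g \o v).
  exists chi; first by rewrite -gE.
  by move=> phi; rewrite -gE => /chiP H u; rewrite -2!(gE _ u); apply: H.
have /choice[u uP] : forall x, exists i, c i = g (v x).
  move=> x; have [i _ ci] : range c (g (v x)) by rewrite -grange; exists (v x).
  by exists i.
have [n [c' [un iso cc']]] := cP (\max_x u x).
have unx x : u x < n.+1 by rewrite ltnS; apply: leq_trans un; exact: (leq_bigmax x).
rewrite (_ : g \o v = (c' \o val) \o (fun x => Ordinal (unx x))).
  exact: isolated_subtuple.
by apply/funext => x /=; rewrite -uP cc' // -ltnS.
Qed.

(** Finitely many isolating formulas suffice for all tuples, for otherwise some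
    tuple would satisfy the negations of all of them. *)
Lemma omega_categorical_formulas (V : finType) : finitely_many_formulas G V.
Proof.
have [a aP] := enumerable_ffun V enumD.
have /choice[chi /all_and2[chia chiP]] : forall i, exists chi, holds G (a i) chi /\
    forall phi, holds G (a i) phi -> forall w, holds G w chi -> holds G w phi.
  by move=> i; have [chi] := omega_categorical_atomic (a i); exists chi.
pose psi := fix psi n := if n is m.+1 then FAnd (psi m) (FNot (chi m)) else FNot FFalse.
have psiP n v : holds G v (psi n) <-> forall i, i < n -> ~ holds G v (chi i).
  elim: n => [|n IH] /=; first by split=> // _ [].
  split=> [[/IH vn vchi] i|H].
    by rewrite ltnS leq_eqVlt => /orP[/eqP->|/vn].
  by split; [apply/IH => i /ltnW/H|exact: H].
have [N NP] : exists N, ~ exists v, holds G v (psi N).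
  apply: contrapT => no.
  have [||v vP] := @omega_categorical_realizes V psi.
  - by move=> n v /= [].
  - by move=> n; apply: contrapT => nex; apply: no; exists n.
  - have [i iv] := aP v; have /psiP/(_ i) := vP i.+1.
    by apply => //; rewrite -iv.
apply: (@finitely_many_types_formulas _ _ _ _ N (fun i => a i)) => v.
have [i vi] : exists i : 'I_N, holds G v (chi i).
  apply: contrapT => no; apply: NP; exists v; apply/psiP => i iN vi.
  by apply: no; exists (Ordinal iN).
by exists i; apply: same_typeW => phi /chiP; apply.
Qed.

End Omega_categorical.

Lemma oligomorphic_omega_categorical (s : signature) (D : Type) (G : structure s D) :
  ([set: D] #= [set: nat])%card -> countable_signature s -> oligomorphic G ->
  omega_categorical G.
Proof.
move=> Dnat hs olig; split=> // E M Enat GM.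
have enum (T : Type) : ([set: T] #= [set: nat])%card -> enumerable T.
  rewrite card_eq_le => /andP[cT /infiniteP/infinite_setN0[x _]].
  exact: (enumerable_countable x).
have [h [h' [hK h'K hh hh']] _] := back_and_forth (enum _ Dnat) (enum _ Enat)
  (fun V => oligomorphic_formulas V olig) (same_typeW GM).
by exists h, h'.
Qed.

Lemma finite_or_omega_categorical_oligomorphic (s : signature) (D : pointedType)
    (G : structure s D) :
  finite_or_omega_categorical G -> enumerable D /\ oligomorphic G.
Proof.
move=> [Dfin|cat].
  split; last exact: finite_oligomorphic.
  exact/(enumerable_countable point)/finite_set_countable.
have De : enumerable D.
  apply: (enumerable_countable point).
  by case: cat; rewrite card_eq_le => /andP[].
by split=> //; apply: formulas_oligomorphic => // V; exact: omega_categorical_formulas.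
Qed.

(** * Polymorphisms and primitive positive definability *)

Lemma hom_atomic_conjunction (s : signature) (D E : Type) (G : structure s D)
    (M : structure s E) (h : D -> E) (V : Type) (v : V -> D) (phi : formula s V) :
  homomorphism G M h -> atomic_conjunction phi -> holds G v phi -> holds M (h \o v) phi.
Proof.
move=> hom; elim: phi v => //= {V}.
- by move=> V t u v _ tu; rewrite -!(teval_hom _ _ hom) tu.
- move=> V r ts v _; have [hr _] := hom => /hr; congr (relI M _).
  by apply/funext => i /=; rewrite (teval_hom _ _ hom).
- by move=> V phi IH psi IH' v /andP[p1 p2] [/(IH _ p1) ? /(IH' _ p2) ?].
Qed.

Lemma hom_pp (s : signature) (D E : Type) (G : structure s D)
    (M : structure s E) (h : D -> E) (V : Type) (v : V -> D) (phi : formula s V) :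
  homomorphism G M h -> primitive_positive phi -> holds G v phi -> holds M (h \o v) phi.
Proof.
move=> hom; elim: phi v => {V}.
- by [].
- by move=> V t u v; apply: hom_atomic_conjunction.
- by move=> V r ts v; apply: hom_atomic_conjunction.
- by [].
- by move=> V phi _ psi _ v; apply: hom_atomic_conjunction.
- move=> V phi IH v /= pp [x /(IH _ pp) hx]; exists (h x).
  by congr holds: hx; apply/funext => -[].
Qed.

Lemma teval_power (s : signature) (D : Type) (G : structure s D) (k : nat)
    (V : Type) (v : V -> 'I_k -> D) (t : term s V) (j : 'I_k) :
  teval (power G k) v t j = teval G (v^~ j) t.
Proof. by elim: t => //= f ts IH; congr funI; apply/funext => i. Qed.

Lemma atomic_conjunction_power (s : signature) (D : Type) (G : structure s D)
    (k : nat) (V : Type) (v : V -> 'I_k.+1 -> D) (phi : formula s V) :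
  atomic_conjunction phi ->
  holds (power G k.+1) v phi <-> forall j, holds G (v^~ j) phi.
Proof.
elim: phi v => //= {V}.
- by move=> V v _; split=> // /(_ ord0).
- move=> V t u v _; split=> [tu j|tu]; first by rewrite -!teval_power tu.
  by apply/funext => j; rewrite !teval_power.
- move=> V r ts v _.
  have E j : (fun i => teval (power G k.+1) v (ts i) j) = fun i => teval G (v^~ j) (ts i).
    by apply/funext => i; rewrite teval_power.
  by split=> H j; have := H j; rewrite E.
- move=> V phi IH psi IH' v /andP[p1 p2].
  by split=> [[/(IH _ p1) H /(IH' _ p2) H'] j|H] //;
    split; [apply/(IH _ p1) => j; have [] := H j|apply/(IH' _ p2) => j; have [] := H j].
Qed.

Lemma pp_power (s : signature) (D : Type) (G : structure s D)
    (k : nat) (V : Type) (v : V -> 'I_k.+1 -> D) (phi : formula s V) :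
  primitive_positive phi ->
  holds (power G k.+1) v phi <-> forall j, holds G (v^~ j) phi.
Proof.
elim: phi v => {V}.
- by move=> V v; apply: atomic_conjunction_power.
- by move=> V t u v; apply: atomic_conjunction_power.
- by move=> V r ts v; apply: atomic_conjunction_power.
- by [].
- by move=> V phi _ psi _ v; apply: atomic_conjunction_power.
- move=> V phi IH v /= pp.
  have E (x : 'I_k.+1 -> D) j : (oapp v x)^~ j = oapp (v^~ j) (x j).
    by apply/funext => -[].
  split=> [[x /(IH _ pp) hx] j|/choice[x hx]].
    by exists (x j); rewrite -E.
  by exists x; apply/(IH _ pp) => j; rewrite E.
Qed.

Definition preserves (D : pointedType) (m : nat) (f : op D m) (V : Type)
    (A : set (V -> D)) :=
  forall a : 'I_m.+1 -> V -> D, (forall j, A (a j)) -> A (fun x => f (fun j => a j x)).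

Lemma Pol_preserves_pp (s : signature) (D : pointedType) (G : structure s D)
    (m : nat) (f : op D m) (V : Type) (phi : formula s V) :
  Pol G (existT _ m f) -> primitive_positive phi -> preserves f [set v | holds G v phi].
Proof.
move=> Pf pp a aP; apply: (hom_pp (v := fun x j => a j x) Pf pp).
exact/(pp_power _ _ pp).
Qed.

Definition pp_implies (s : signature) (D E : Type) (G : structure s D)
    (M : structure s E) (V : Type) (v : V -> D) (w : V -> E) :=
  forall phi : formula s V, primitive_positive phi -> holds G v phi -> holds M w phi.

(** A homomorphism is built by extending finite maps that preserve the
    satisfaction of primitive positive formulas. *)
Lemma pp_implies_hom (s : signature) (D E : Type) (G : structure s D)
    (M : structure s E) (V : finType) (v : V -> D) (w : V -> E) :
  enumerable D -> (forall V : finType, finitely_many_formulas M V) ->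
  pp_implies G M v w -> exists2 h, homomorphism G M h & h \o v = w.
Proof.
move=> [e eP] fin vw.
pose graph (W : finType) (v : W -> D) (w : W -> E) : set (D * E) :=
  [set x | exists i, x = (v i, w i)].
have [||F [p0F FQ Ffin]] := @generic_union _
    (fun p => exists (W : finType) (v : W -> D) (w : W -> E),
      pp_implies G M v w /\ p = graph W v w)
    (fun n x => x.1 = e n) (graph V v w).
- by exists V, v, w.
- move=> n p [W [v' [w' [vw' ->]]]].
  have [||chi [ppchi hchi] chi_min] := @least_formula _ _ M _
      [set phi | primitive_positive phi /\ holds G (oapp v' (e n)) phi] (fin (option W)).
  + by exists (FEq (Var None) (Var None)).
  + move=> phi psi [pphi hphi] [ppsi hpsi]; have [chi ppchi chiP] := pp_conj pphi ppsi.
    by exists chi => [|u /chiP //]; split=> //; apply/chiP.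
  have [b hb] : holds M w' (FEx chi) by apply: vw' => //; exists (e n).
  exists (e n, b) => //; exists (option W), (oapp v' (e n)), (oapp w' b); split.
    by move=> phi pp hphi; exact: chi_min hb.
  apply/seteqP; split=> x /=.
    by move=> [[i ->]|->]; [exists (Some i)|exists None].
  by move=> [[i|] ->]; [left; exists i|right].
have Fpp (W : finType) (u : W -> D * E) :
    (forall i, F (u i)) -> pp_implies G M (fst \o u) (snd \o u).
  move=> /Ffin[p [[W' [v' [w' [vw' ->]]]] _ _ /choice[f fP]]] phi pp.
  have -> : fst \o u = v' \o f by apply/funext => x /=; rewrite fP.
  have -> : snd \o u = w' \o f by apply/funext => x /=; rewrite fP.
  by rewrite -(holds_rename _ phi f v') -(holds_rename _ phi f w'); apply: vw'; rewrite primitive_positive_rename.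
have /choice[h hF] : forall a, exists b, F (a, b).
  move=> a; have [n <-] := eP a; have [[a' b] /=] := FQ n.
  by move=> ->; exists b.
have hE a b : F (a, b) -> h a = b.
  move=> Fab; pose u (i : bool) := if i then (a, h a) else (a, b).
  have /Fpp/(_ (FEq (Var true) (Var false)) isT erefl) // : forall i, F (u i).
  by move=> []; [exact: hF|exact: Fab].
exists h; last by apply/funext => i /=; apply: hE; apply: p0F; exists i.
split=> [r a|f a].
  have /Fpp/(_ (FRel r Var) isT) : forall i, F (a i, (h \o a) i) by move=> i; exact: hF.
  exact.
pose u i := (oapp a (funI G a) i, oapp (h \o a) (h (funI G a)) i).
have /Fpp/(_ (FEq (Var None) (App f (Var \o Some))) isT)/= : forall i, F (u i).
  by move=> [i|]; exact: hF.
by move=> ->.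
Qed.

(** The tuples of [A] lie in finitely many orbits. Listing representatives as
    the coordinates of one tuple over a power of [G], the set [A] consists of the
    images of this tuple under homomorphisms from that power, that is, of the
    tuples satisfying the strongest primitive positive formula that holds
    of it. *)
Theorem preserved_pp_definable (s : signature) (D : pointedType)
    (G : structure s D) (V : finType) (A : set (V -> D)) :
  enumerable D -> oligomorphic G ->
  (forall m (f : op D m), Pol G (existT _ m f) -> preserves f A) ->
  pp_definable G A.
Proof.
move=> De olig pres.
have [A0|none] := pselect (A !=set0); last first.
  by exists FFalse => //; apply/seteqP; split=> v //= Av; case: none; exists v.
have [m [l [lA lP]]] := orbit_representatives olig A0.
have fin (W : finType) : finitely_many_formulas G W := oligomorphic_formulas W olig.
have [||phi [pphi phil] phi_min] := @least_formula _ _ G _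
    [set phi | primitive_positive phi /\ forall i, holds G (l i) phi] (fin V).
- by exists (FEx (FEq (Var None) (Var None))); split=> // i; exists point.
- move=> phi psi [pphi hphi] [ppsi hpsi]; have [chi ppchi chiP] := pp_conj pphi ppsi.
  by exists chi => [|u /chiP //]; split=> // i; apply/chiP.
exists phi => //; apply/seteqP; split=> v /=.
  by move=> /lP[i [alpha aut <-]]; rewrite (isomorphism_holds _ _ aut).
move=> vphi.
have [|f Pf <-] := @pp_implies_hom _ _ _ (power G m.+1) G V (fun x j => l j x) v
    (enumerable_ffun _ De) fin.
  by move=> psi ppsi /(pp_power _ _ ppsi) hpsi; apply: phi_min vphi.
exact: (pres m f).
Qed.

(** * The topology on operations *)

Definition agree_on (D E : Type) (I : Type) (x : I -> D) (f g : D -> E) :=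
  forall i, g (x i) = f (x i).

Lemma nbhs_op (D : pointedType) (k : nat) (f : op D k) (A : set (op D k)) :
  nbhs f A <-> exists (I : finType) (x : I -> 'I_k.+1 -> D),
    forall g : op D k, agree_on x f g -> A g.
Proof.
pose F : set_system (op D k) := [set B | exists (I : finType) (x : I -> 'I_k.+1 -> D),
    forall g : op D k, agree_on x f g -> B g].
have FF : Filter F.
  split.
  - by exists void, (of_void _).
  - move=> P Q [I [x xP]] [J [y yQ]].
    exists (I + J)%type, (sum_rect _ x y) => g gP; split.
      by apply: xP => i; exact: (gP (inl i)).
    by apply: yQ => i; exact: (gP (inr i)).
  - by move=> P Q PQ [I [x xP]]; exists I, x => g /xP/PQ.
suff -> : nbhs f = F by [].
apply/seteqP; split.
  have : F --> f.
    apply/cvg_sup => x B.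
    rewrite (@nbhsE (initial_topology
      (fun h : op D k => h x))) => -[_ [[C Cop <-] Cf] CB].
    by exists unit, (fun=> x) => g /(_ tt) gx; apply: CB; rewrite /preimage /= gx.
  exact.
have FN : @Filter (op D k) (nbhs f) := nbhs_filter f.
move=> B [I [x xB]]; apply: (@filterS (op D k) _ FN [set g | agree_on x f g]) => //.
apply: (@filter_forall (op D k) I (fun i g => g (x i) = f (x i)) _ FN) => i.
have /(_ f) := @proj_continuous ('I_k.+1 -> D) (fun=> discrete_topology D) (x i).
by move=> /(_ _ (discrete_set1 _)).
Qed.

Lemma nbhs_ops (D : pointedType) (k : nat) (f : op D k) (A : set (ops D)) :
  nbhs (existT _ k f : ops D) A <-> exists (I : finType) (x : I -> 'I_k.+1 -> D),
    forall g : op D k, agree_on x f g -> A (existT _ k g).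
Proof. exact: (nbhs_op f (fun g => A (existT _ k g))). Qed.

(** Pointwise, continuity says that each value of [xi k f] depends on finitely
    many values of [f]; how many, and which ones, may still depend on [f]. *)
Lemma continuous_ops_map (D E : pointedType) (C : set (ops D))
    (xi : forall k, op D k -> op E k) :
  {within C, continuous (ops_map xi)} <->
  forall k (f : op D k) (y : 'I_k.+1 -> E), C (existT _ k f) ->
    exists (I : finType) (x : I -> 'I_k.+1 -> D), forall g : op D k,
      C (existT _ k g) -> agree_on x f g -> xi k g y = xi k f y.
Proof.
rewrite subspace_continuousP; split=> [cont k f y Cf|fin [k f] Cf A].
  pose A : set (ops E) := [set h | forall z : 'I_(projT1 h).+1 -> E,
    existT (fun n => 'I_n.+1 -> E) _ z = existT _ k y -> (projT2 h : op E (projT1 h)) z = xi k f y].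
  have /(cont _ Cf) : nbhs (ops_map xi (existT _ k f)) A.
    apply/nbhs_ops; exists unit, (fun=> y) => g /(_ tt) gy z.
    move=> zy; have zy' : z = y := existT_inj2 zy.
    by rewrite zy'.
  move=> /nbhs_ops[I [x xP]]; exists I, x => g Cg /xP /(_ Cg y).
  exact.
move=> /nbhs_ops[I [x xP]]; apply/nbhs_ops.
pose J i := cid (fin k f (x i) Cf); pose y i := cid (projT2 (J i)).
exists {i : I & projT1 (J i)}, (fun ij => sval (y (projT1 ij)) (projT2 ij)) => g gP Cg.
apply: xP => i; apply: (svalP (y i)) => // j; exact: (gP (existT _ i j)).
Qed.

Lemma closure_ops (D : pointedType) (k : nat) (g : op D k) (B : set (ops D)) :
  closure B (existT _ k g) <->
  forall (I : finType) (x : I -> 'I_k.+1 -> D),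
    exists2 h : op D k, B (existT _ k h) & agree_on x g h.
Proof.
split=> [cl I x|H A /nbhs_ops[I [x xA]]].
  pose A : set (ops D) := [set h | exists2 h' : op D k, h = existT _ k h' & agree_on x g h'].
  have /cl[h [Bh [h' hh' h'P]]] : nbhs (existT _ k g : ops D) A.
    by apply/nbhs_ops; exists I, x => h' h'P; exists h'.
  by exists h' => //; rewrite -hh'.
by have [h Bh /xA] := H I x; exists (existT _ k h).
Qed.

(** * From continuous clone homomorphisms to interpretations *)

Lemma PolP (s : signature) (D : pointedType) (G : structure s D) (m : nat)
    (f : op D m) :
  Pol G (existT _ m f) <->
  (forall r : relsym s, preserves f (@relI _ _ G r)) /\
  (forall (g : funsym s) (a : 'I_m.+1 -> 'I_(farity g) -> D),
     f (fun j => funI G (a j)) = funI G (fun i => f (fun j => a j i))).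
Proof.
split=> [[fr ff]|[fr ff]]; split.
- by move=> r a ar; exact: (fr r (fun i j => a j i)).
- by move=> g a; exact: (ff g (fun i j => a j i)).
- by move=> r a ar; exact: (fr r (fun j i => a i j)).
- by move=> g a; exact: (ff g (fun j i => a i j)).
Qed.

Lemma Pol_comp (s : signature) (D : pointedType) (G : structure s D) (n m : nat)
    (f : op D n) (g : 'I_n.+1 -> op D m) :
  Pol G (existT _ n f) -> (forall i, Pol G (existT _ m (g i))) ->
  Pol G (existT _ m (comp_op f g)).
Proof.
move=> /PolP[fr ff] gP; apply/PolP; split=> [r a ar|h a].
  apply: (fr r (fun i x => g i (fun j => a j x))) => i.
  by have /PolP[gr _] := gP i; exact: gr.
rewrite /comp_op -ff; congr f; apply/funext => i.
by have /PolP[_ gf] := gP i; exact: gf.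
Qed.

Definition unary (D : pointedType) (alpha : D -> D) (k : nat) (i : 'I_k.+1) :
  op D k := fun x => alpha (x i).

Lemma Pol_unary (s : signature) (D : pointedType) (G : structure s D)
    (alpha : D -> D) (k : nat) (i : 'I_k.+1) :
  homomorphism G G alpha -> Pol G (existT _ k (unary alpha i)).
Proof.
by move=> [ar af]; apply/PolP; split=> [r a /(_ i)/ar|g a] //; exact: af.
Qed.

Lemma Pol_diagonal (s : signature) (D : pointedType) (G : structure s D)
    (k : nat) (f : op D k) :
  Pol G (existT _ k f) -> homomorphism G G (fun x => f (fun=> x) : D).
Proof.
move=> /PolP[fr ff]; split=> [r a ar|g a]; first exact: (fr r (fun=> a)).
exact: (ff g (fun=> a)).
Qed.

Lemma clone_homomorphism_cancel (s : signature) (D E : pointedType)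
    (G : structure s D) (C : set (ops E)) (xi : forall k, op D k -> op E k)
    (alpha alpha' : D -> D) (e : E) :
  clone_homomorphism (Pol G) C xi -> cancel alpha alpha' ->
  homomorphism G G alpha -> homomorphism G G alpha' ->
  xi 0 (unary alpha' ord0) (fun=> xi 0 (unary alpha ord0) (fun=> e)) = e.
Proof.
move=> [_ xiproj xicomp] aK ha ha'.
pose u := @unary D alpha 0 ord0; pose u' := @unary D alpha' 0 ord0.
have E1 : comp_op u' (fun=> u) = proj_op ord0.
  by apply/funext => x; rewrite /comp_op /u' /u /unary /= aK.
have := xicomp _ _ u' (fun=> u) (Pol_unary ord0 ha') (fun=> Pol_unary ord0 ha).
rewrite E1 xiproj => /(congr1 (fun h : op E 0 => h (fun=> e))) E2.
exact: esym E2.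
Qed.

(** Through [xi], an automorphism acts on [E] by a bijection, which can be
    cancelled. *)
Lemma clone_homomorphism_automorphism (s : signature) (D E : pointedType)
    (G : structure s D) (C : set (ops E)) (xi : forall k, op D k -> op E k)
    (alpha alpha' : D -> D) (k : nat) (f g : op D k) (b : 'I_k.+1 -> E) :
  clone_homomorphism (Pol G) C xi -> cancel alpha alpha' ->
  homomorphism G G alpha -> homomorphism G G alpha' ->
  Pol G (existT _ k f) -> Pol G (existT _ k g) ->
  xi k (fun x => alpha (f x)) b = xi k (fun x => alpha (g x)) b ->
  xi k f b = xi k g b.
Proof.
move=> xihom aK ha ha' Pf Pg; have [_ _ xicomp] := xihom.
pose u := @unary D alpha 0 ord0.
have xiu h : Pol G (existT _ k h) ->
    xi k (fun x => alpha (h x)) b = xi 0 u (fun=> xi k h b).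
  move=> Ph; have -> : (fun x => alpha (h x)) = comp_op u (fun=> h) by [].
  by rewrite (xicomp _ _ u (fun=> h) (Pol_unary ord0 ha) (fun=> Ph)).
rewrite !xiu // => fg.
rewrite -(clone_homomorphism_cancel (xi k f b) xihom aK ha ha') fg.
exact: (clone_homomorphism_cancel (xi k g b) xihom aK ha ha').
Qed.

Lemma clone_homomorphism_isomorphism (s t : signature) (D E : pointedType)
    (G : structure s D) (H : structure t E) (xi : forall k, op D k -> op E k)
    (alpha : D -> D) :
  clone_homomorphism (Pol G) (Pol H) xi -> isomorphism G G alpha ->
  isomorphism H H (fun e => xi 0 (unary alpha ord0) (fun=> e) : E).
Proof.
move=> xihom [alpha' [aK a'K ha ha']]; have [xipol _ _] := xihom.
exists (fun e => xi 0 (unary alpha' ord0) (fun=> e)); split.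
- by move=> e; exact: (clone_homomorphism_cancel e xihom aK ha ha').
- by move=> e; exact: (clone_homomorphism_cancel e xihom a'K ha' ha).
- exact: Pol_diagonal (xipol _ (Pol_unary ord0 ha)).
- exact: Pol_diagonal (xipol _ (Pol_unary ord0 ha')).
Qed.

(** Continuity of a clone homomorphism is uniform: a compactness argument, in
    which the polymorphisms of [G] form a compact space up to composition with
    automorphisms, because there are finitely many orbits of tuples. If no
    finite set worked, a polymorphism [f] could be built point by point such
    that every finite part of [f] is shared by polymorphisms that agree
    on a prescribed finite set although their images differ at [b]; this
    contradicts continuity at [f]. *)
Lemma uniformly_continuous (s : signature) (D E : pointedType)
    (G : structure s D) (C : set (ops E)) (xi : forall k, op D k -> op E k)
    (k : nat) (b : 'I_k.+1 -> E) :
  enumerable D -> oligomorphic G -> continuous_clone_homomorphism (Pol G) C xi ->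
  exists (I : finType) (x : I -> 'I_k.+1 -> D), forall f g : op D k,
    Pol G (existT _ k f) -> Pol G (existT _ k g) -> agree_on x f g ->
    xi k f b = xi k g b.
Proof.
move=> De olig [xiclone /continuous_ops_map xicont]; apply: contrapT => nouni.
pose graph (V : finType) (v : V -> 'I_k.+1 -> D) (w : V -> D) :
  set (('I_k.+1 -> D) * D) := [set z | exists i, z = (v i, w i)].
pose bad (p : set (('I_k.+1 -> D) * D)) (I : finType) (x : I -> 'I_k.+1 -> D) :=
  exists f g : op D k, [/\ Pol G (existT _ k f), Pol G (existT _ k g),
    agree_on x f g, forall z, p z -> f z.1 = z.2 & xi k f b <> xi k g b].
have [e eP] := enumerable_ffun 'I_k.+1 De.
have [||F [_ FQ Ffin]] := @generic_union _
    (fun p => (exists V v w, p = graph V v w) /\ forall I x, bad p I x)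
    (fun n z => z.1 = e n) (graph void (of_void _) (of_void _)).
- split; first by exists void, (of_void _), (of_void _).
  move=> I x; apply: contrapT => good; apply: nouni; exists I, x => f g Pf Pg fg.
  by apply: contrapT => neq; apply: good; exists f, g; split=> // z [[]].
- move=> n p [[V [v [w pE]]] pbad].
  have [|m [l [lA lP]]] := orbit_representatives
      (A := [set u : option V -> D | u \o Some = w]) olig.
    by exists (oapp w point).
  (* If each value [l i None] failed for some finite set, all would fail for the
     union of these sets. There [p] provides [f] and [g]; an automorphism over
     the values of [p] moves [f (e n)] to some [l i None]. *)
  have [i ibad] : exists i, forall I x, bad (p `|` [set (e n, l i None)]) I x.
    apply: contrapT => noi.
    have good i : exists I, ~ forall x, bad (p `|` [set (e n, l i None)]) I x.
      by apply: contrapT => nI; apply: noi; exists i => I; apply: contrapT => nx;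
        apply: nI; exists I.
    pose J i := cid (good i).
    have xJ i : {x | ~ bad (p `|` [set (e n, l i None)]) (projT1 (J i)) x}.
      by apply: cid; apply: contrapT => nx; apply: (svalP (J i)) => x;
        apply: contrapT => bx; apply: nx; exists x.
    have [f [g [Pf Pg fg fp neq]]] := pbad {i & projT1 (J i) : finType}
      (fun ij => sval (xJ (projT1 ij)) (projT2 ij)).
    have fv j : f (v j) = w j by apply: (fp (v j, w j)); rewrite pE; exists j.
    have [|i [alpha [alpha' [aK a'K ha ha']] aE]] := lP (oapp w (f (e n))).
      by apply/funext.
    have aE' j : alpha' (oapp w (f (e n)) j) = l i j by rewrite -aE /= aK.
    have Pu h : Pol G (existT _ k h) -> Pol G (existT _ k (fun x => alpha' (h x) : D)).
      move=> Ph; apply: (@Pol_comp _ _ _ 0 k (unary alpha' ord0) (fun=> h)) => //.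
      exact: Pol_unary.
    apply: (svalP (xJ i)); exists (fun x => alpha' (f x)), (fun x => alpha' (g x)).
    split; try exact: Pu.
    + by move=> j; congr alpha'; exact: (fg (existT _ i j)).
    + move=> z [pz|->] /=; last exact: (aE' None).
      move: (pz); rewrite pE => -[j ->] /=; rewrite fv (aE' (Some j)).
      by have /(congr1 (fun h => h j)) := lA i.
    + move=> /(clone_homomorphism_automorphism xiclone a'K ha' ha Pf Pg).
      exact: neq.
  exists (e n, l i None) => //; split=> //.
  exists (option V), (oapp v (e n)), (oapp w (l i None)); rewrite pE.
  apply/seteqP; split=> x /=.
    by move=> [[j ->]|->]; [exists (Some j)|exists None].
  by move=> [[j|] ->]; [left; exists j|right].
have Fbad (V I : finType) (u : V -> 'I_k.+1 -> D) (x : I -> 'I_k.+1 -> D) (w : V -> D) :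
    (forall j, F (u j, w j)) -> exists f g : op D k,
    [/\ Pol G (existT _ k f), Pol G (existT _ k g), agree_on x f g,
      forall j, f (u j) = w j & xi k f b <> xi k g b].
  move=> /Ffin[p [[_ /(_ I x)[f [g [Pf Pg fg fp neq]]]] _ _ pu]].
  by exists f, g; split=> // j; exact: (fp _ (pu j)).
have /choice[f fF] : forall z, exists d, F (z, d).
  move=> z; have [n <-] := eP z; have [[z' d] /=] := FQ n.
  by move=> ->; exists d.
have Fpart (V : finType) (u : V -> 'I_k.+1 -> D) : exists2 g : op D k,
    Pol G (existT _ k g) & forall j, g (u j) = f (u j).
  have [g [_ [Pg _ _ gu _]]] := Fbad V void u (of_void _) (f \o u) (fun j => fF (u j)).
  by exists g.
have Pf : Pol G (existT _ k (f : op D k)).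
  apply/PolP; split=> [r a ar|h a].
    have [g /PolP[gr _] gu] := Fpart _ (fun i j => a j i).
    have := gr r a ar; congr (relI G _); exact/funext.
  have [g /PolP[_ gf] gu] := Fpart _
    (oapp (fun i j => a j i) (fun j => funI G (a j))).
  have := gf h a; rewrite (gu None) /= => ->; congr funI; apply/funext => i.
  exact: (gu (Some i)).
have [I [x xP]] := xicont k f b Pf.
have [g [g' [Pg Pg' gg' gx neq]]] := Fbad I I x x (f \o x) (fun j => fF (x j)).
by apply: neq; rewrite !xP // => j; rewrite gg' gx.
Qed.

(** The coordinate map of [I] is a homomorphism from the action of [Pol G] on
    the domain of [I] to its action on [E] through [xi]. *)
Definition induces (s t : signature) (D E : pointedType) (H : structure s E)
    (G : structure t D) (I : interpretation H G) (xi : forall k, op D k -> op E k) :=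
  forall (m : nat) (f : op D m), Pol G (existT _ m f) ->
  forall a : 'I_m.+1 -> 'I_(idim I) -> D, (forall j, interp_dom I (a j)) ->
    icoord I (fun c => f (fun j => a j c)) = xi m f (fun j => icoord I (a j)).

Lemma unnested_atomic_pp (s : signature) (V : Type) (phi : formula s V) :
  unnested_atomic phi -> primitive_positive phi.
Proof.
case=> [[x [y ->]] //|[x [f [xs ->]]] //|[r [xs ->]] //].
Qed.

(** The defining formulas need not be exhibited: if [h] carries the action of
    [Pol G] to operations of [Pol H], the preimages of relations of [H] are
    preserved by [Pol G]. *)
Lemma interpretation_of_action (s t : signature) (D E : pointedType)
    (H : structure s E) (G : structure t D) (d : nat) (S : set ('I_d.+1 -> D))
    (h : ('I_d.+1 -> D) -> E) (xi : forall k, op D k -> op E k) :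
  enumerable D -> oligomorphic G ->
  (forall e, exists2 a, S a & h a = e) ->
  (forall m (f : op D m), Pol G (existT _ m f) ->
    [/\ Pol H (existT _ m (xi m f)), preserves f S &
      forall a : 'I_m.+1 -> 'I_d.+1 -> D, (forall j, S (a j)) ->
        h (fun c => f (fun j => a j c)) = xi m f (fun j => h (a j))]) ->
  exists I : interpretation H G, pp_interpretation I /\ induces I xi.
Proof.
move=> De olig h_surj act.
have [dom ppdom domE] := preserved_pp_definable De olig
  (fun m f Pf => let: And3 _ fS _ := act m f Pf in fS).
have domP a : S a <-> holds G a dom by rewrite domE.
pose B k (phi : formula s 'I_k) : set ('I_k * 'I_d.+1 -> D) :=
  [set v | (forall i, S (fun c => v (i, c))) /\ holds H (fun i => h (fun c => v (i, c))) phi].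
have defB k (phi : formula s 'I_k) : {psi | unnested_atomic phi ->
    primitive_positive psi /\ B k phi = [set v | holds G v psi]}.
  apply: cid; have [un|nun] := pselect (unnested_atomic phi); last by exists FFalse.
  suff [psi pp psiE] : pp_definable G (B k phi) by exists psi.
  apply: preserved_pp_definable => // m f /act[Pxi fS fh] v vB; split.
    by move=> i; apply: (fS (fun j c => v j (i, c))) => j; have [] := vB j.
  rewrite (_ : (fun i => _) = fun i => xi m f (fun j => h (fun c => v j (i, c)))).
    apply: (Pol_preserves_pp Pxi (unnested_atomic_pp un)) => j.
    by have [] := vB j.
  by apply/funext => i; rewrite -fh // => j; have [] := vB j.
have defP k (phi : formula s 'I_k) : unnested_atomic phi ->
    forall a : 'I_k -> 'I_d.+1 -> D, (forall i, holds G (a i) dom) ->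
      (holds H (fun i => h (a i)) phi <->
       holds G (fun ij => a ij.1 ij.2) (sval (defB k phi))).
  move=> un a adom; have [_ BE] := svalP (defB k phi) un.
  have <- : B k phi (fun ij => a ij.1 ij.2) =
      holds G (fun ij => a ij.1 ij.2) (sval (defB k phi)).
    exact: (congr1 (fun A => A (fun ij => a ij.1 ij.2)) BE).
  split=> [hphi|[]//]; split=> // i; exact/domP/adom.
have surj e : exists2 a, holds G a dom & h a = e.
  by have [a /domP] := h_surj e; exists a.
exists (@Interpretation s t D E H G d.+1 dom (fun k phi => sval (defB k phi)) h
  (ltn0Sn d) surj defP).
split=> [|m f /act[_ _ fh] a aS]; last by apply: fh => j; exact/domP/aS.
by split=> // k phi un; have [] := svalP (defB k phi) un.
Qed.

(** The points of [E] are the values [xi k f b] for a fixed tuple [b] meeting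
    all orbits, and by uniform continuity such a value depends on a fixed
    finite part of [f] only. These finite parts are the domain of the
    interpretation. *)
Theorem clone_homomorphism_interpretation (s t s' : signature) (D E : pointedType)
    (H : structure s E) (G : structure t D) (H' : structure s' E)
    (xi : forall k, op D k -> op E k) :
  enumerable D -> oligomorphic G -> oligomorphic H' -> Pol H' `<=` Pol H ->
  continuous_clone_homomorphism (Pol G) (Pol H') xi ->
  Pol H' `<=` closure (ops_map xi @` Pol G) ->
  exists I : interpretation H G, pp_interpretation I /\ induces I xi.
Proof.
move=> De olig olig' PolH xicont dense.
have [k [l [_ lP]]] : exists (k : nat) (l : 'I_k.+1 -> unit -> E), (forall i, setT (l i)) /\
    forall v, setT v -> exists i, exists2 alpha, isomorphism H' H' alpha & alpha \o l i = v.
  by apply: orbit_representatives => //; exists (fun=> point).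
pose b i := l i tt.
have b_gen e : exists2 f : op D k, Pol G (existT _ k f) & xi k f b = e.
  have [//|i [alpha [alpha' [_ _ ha _]] aE]] := lP (fun=> e).
  have /dense/closure_ops/(_ unit (fun=> b)) [g [[k' f] Pf fg] /(_ tt) gb] :=
    Pol_unary i ha.
  have k'k : k' = k := existT_inj1 fg.
  subst k'.
  exists f => //; rewrite (existT_inj2 fg) gb.
  exact: (congr1 (fun v => v tt) aE).
have [I [x xP]] := uniformly_continuous b De olig xicont.
have [[xipol _ xicomp] _] := xicont.
(* The additional point [y ord0] makes the dimension positive. *)
pose y (c : 'I_(#|I|.+1)) : 'I_k.+1 -> D := oapp (x \o enum_val) (fun=> point) (unlift ord0 c).
have yP (f g : op D k) : Pol G (existT _ k f) -> Pol G (existT _ k g) ->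
    f \o y = g \o y -> xi k f b = xi k g b.
  move=> Pf Pg fg; apply: xP => // i.
  have /(congr1 (fun h => h (lift ord0 (enum_rank i)))) := fg.
  by rewrite /y /= liftK /= enum_rankK.
have /choice[h hP] : forall a : 'I_#|I|.+1 -> D, exists e,
    forall f : op D k, Pol G (existT _ k f) -> a = f \o y -> e = xi k f b.
  move=> a; have [[f [Pf fa]]|no] := pselect (exists f : op D k, Pol G (existT _ k f) /\ a = f \o y).
    by exists (xi k f b) => g Pg ga; apply: yP => //; rewrite -fa.
  by exists point => f Pf fa; case: no; exists f.
apply: (@interpretation_of_action _ _ _ _ _ _ _
  [set a | exists2 f : op D k, Pol G (existT _ k f) & a = f \o y] h) => //.
  by move=> e; have [f Pf <-] := b_gen e; exists (f \o y); [exists f|rewrite (hP _ f)].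
move=> m f Pf; split.
- exact/PolH/(xipol _ Pf).
- move=> a /= aS.
  have /choice[g gP] : forall j, exists g : op D k, Pol G (existT _ k g) /\ a j = g \o y.
    by move=> j; have [g] := aS j; exists g.
  exists (comp_op f g); first by apply: Pol_comp => // j; have [] := gP j.
  by apply/funext => c; congr f; apply/funext => j; have [_ ->] := gP j.
- move=> a /= aS.
  have /choice[g gP] : forall j, exists g : op D k, Pol G (existT _ k g) /\ a j = g \o y.
    by move=> j; have [g] := aS j; exists g.
  have Pg j : Pol G (existT _ k (g j)) by have [] := gP j.
  rewrite (hP _ (comp_op f g)).
  + rewrite xicomp // /comp_op; congr (xi m f); apply/funext => j.
    by rewrite (hP _ (g j)) //; have [] := gP j.
  + exact: Pol_comp.
  + by apply/funext => c; congr f; apply/funext => j; have [_ ->] := gP j.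
Qed.

(** * From interpretations to continuous clone homomorphisms *)

Section Induced_homomorphism.
Variables (s t : signature) (D E : pointedType).
Variables (H : structure s E) (G : structure t D) (I : interpretation H G).
Hypothesis ppI : pp_interpretation I.

Let S := interp_dom I.
Let h := icoord I.

Lemma interp_dom_preserved (m : nat) (f : op D m) :
  Pol G (existT _ m f) -> preserves f S.
Proof. by move=> Pf; case: ppI => ppdom _; exact: Pol_preserves_pp. Qed.

Lemma interp_atomic_preserved (m k : nat) (f : op D m) (phi : formula s 'I_k)
    (a : 'I_m.+1 -> 'I_k -> 'I_(idim I) -> D) :
  unnested_atomic phi -> Pol G (existT _ m f) -> (forall j i, S (a j i)) ->
  (forall j, holds H (fun i => h (a j i)) phi) ->
  holds H (fun i => h (fun c => f (fun j => a j i c))) phi.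
Proof.
move=> un Pf aS ha; have [_ ppdef] := ppI.
have fS i : S (fun c => f (fun j => a j i c)).
  exact: (interp_dom_preserved Pf (a := fun j => a j i)).
apply/(idefP un fS).
apply: (Pol_preserves_pp Pf (ppdef _ _ un) (a := fun j ij => a j ij.1 ij.2)) => j.
exact/(idefP un (aS j)).
Qed.

Lemma interp_section : exists lift : E -> 'I_(idim I) -> D,
  forall e, S (lift e) /\ h (lift e) = e.
Proof.
have /choice[lift liftP] : forall e, exists a, S a /\ h a = e.
  by move=> e; have [a] := icoord_surj I e; exists a.
by exists lift.
Qed.

(** The coordinate map identifies tuples of the domain, and [f] respects this
    since the kernel of the coordinate map is primitive positive definable. *)
Theorem interpretation_clone_homomorphism :
  exists xi : forall k, op D k -> op E k,
    continuous_clone_homomorphism (Pol G) (Pol H) xi /\ induces I xi.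
Proof.
have [lift liftP] := interp_section.
have liftS e : S (lift e) by have [] := liftP e.
have liftK e : h (lift e) = e by have [] := liftP e.
pose xi m (f : op D m) : op E m := fun z => h (fun c => f (fun j => lift (z j) c)).
have ind : induces I xi.
  move=> m f Pf a aS.
  pose phi : formula s 'I_2 := FEq (Var ord0) (Var ord_max).
  pose a' j (i : 'I_2) := if i == ord0 then a j else lift (h (a j)).
  have un : unnested_atomic phi by constructor 1; exists ord0, ord_max.
  apply: (interp_atomic_preserved (a := a') un Pf) => j /=.
    by move=> i; rewrite /a'; case: ifP => _; [exact: aS|exact: liftS].
  by rewrite /a' /= liftK.
have xiP m (f : op D m) : Pol G (existT _ m f) -> Pol H (existT _ m (xi m f)).
  move=> Pf; apply/PolP; split=> [r a ar|g a].
    pose phi : formula s 'I_(rarity r) := FRel r Var.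
    have un : unnested_atomic phi by constructor 3; exists r, id.
    apply: (interp_atomic_preserved (a := fun j i => lift (a j i)) un Pf) => // j.
    rewrite /= (_ : (fun i => _) = a j) //.
    by apply/funext => i; rewrite liftK.
  pose phi : formula s 'I_(farity g).+1 :=
    FEq (Var ord0) (App g (fun i => Var (fintype.lift ord0 i))).
  have un : unnested_atomic phi by constructor 2; exists ord0, g, (fintype.lift ord0).
  pose a' j i := lift (oapp (a j) (funI H (a j)) (unlift ord0 i)).
  have : holds H (fun i => h (fun c => f (fun j => a' j i c))) phi.
    apply: (interp_atomic_preserved un Pf) => j; first by move=> i; exact: liftS.
    rewrite /= /a' unlift_none liftK; congr funI; apply/funext => i.
    by rewrite fintype.liftK liftK.
  rewrite /= /a' unlift_none => phiE; apply: (etrans phiE); congr funI.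
  apply/funext => i; congr h; apply/funext => c; congr f; apply/funext => j.
  by rewrite fintype.liftK.
exists xi; split=> //; split.
  split=> [[m f] /xiP //|k i|n m f g Pf Pg].
    by apply/funext => z; exact: liftK.
  apply/funext => z; apply: (ind n f Pf (fun i c => g i (fun j => lift (z j) c))) => i.
  exact: (interp_dom_preserved (Pg i) (a := fun j => lift (z j))).
apply/continuous_ops_map => k f y Pf.
exists 'I_(idim I), (fun c j => lift (y j) c) => g Pg fg.
by congr h; apply/funext => c; exact: fg.
Qed.

Definition interp_preimage (n : nat) (R : set ('I_n -> E)) : set ('I_n * 'I_(idim I) -> D) :=
  [set v | (forall i, S (fun c => v (i, c))) /\ R (fun i => h (fun c => v (i, c)))].

Lemma interp_preimage_inj (n : nat) : injective (@interp_preimage n).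
Proof.
have [lift liftP] := interp_section.
move=> R R' RR'; apply/seteqP; split=> u.
- move=> Ru; suff [_] : interp_preimage R' (fun ic => lift (u ic.1) ic.2).
    by congr R'; apply/funext => i; have [_] := liftP (u i).
  rewrite -RR'; split=> [i|]; first by have [] := liftP (u i).
  by congr R: Ru; apply/funext => i; have [_] := liftP (u i).
- move=> Ru; suff [_] : interp_preimage R (fun ic => lift (u ic.1) ic.2).
    by congr R; apply/funext => i; have [_] := liftP (u i).
  rewrite RR'; split=> [i|]; first by have [] := liftP (u i).
  by congr R': Ru; apply/funext => i; have [_] := liftP (u i).
Qed.

(** For oligomorphic [G], the added relations are those preserved by the image
    of [Pol G], so that the polymorphism clone of the expansion is the closure
    of this image. *)
Definition expansion_signature : signature := {|
  relsym := relsym s + {nR : {n & set ('I_n -> E)} |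
                        pp_definable G (interp_preimage (projT2 nR))};
  funsym := funsym s;
  rarity := fun r => match r with inl r => rarity r | inr nR => projT1 (sval nR) end;
  farity := @farity s |}.

Definition expansion : structure expansion_signature E :=
  @Structure expansion_signature E
    (fun r => match r return set ('I_(@rarity expansion_signature r) -> E) with
       | inl r => @relI _ _ H r | inr nR => projT2 (sval nR) end)
    (@funI _ _ H).

Lemma reduct_expansion : reduct H expansion.
Proof. by exists inl, id; split=> // r r' []. Qed.

Variable xi : forall k, op D k -> op E k.
Hypothesis indI : induces I xi.
Hypothesis xicont : continuous_clone_homomorphism (Pol G) (Pol H) xi.

Lemma expansion_clone_homomorphism :
  continuous_clone_homomorphism (Pol G) (Pol expansion) xi.
Proof.
have [[xipol xiproj xicomp] cont] := xicont; split=> //; split=> // -[m f] Pf.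
have [xir xif] := (PolP _ _).1 (xipol _ Pf).
apply/PolP; split=> [[r|[[n R] ppR]] /=|//]; first exact: xir.
move=> a aR; have [lift liftP] := interp_section.
have [phi ppphi phiE] := ppR.
have [] : interp_preimage R (fun ic => f (fun j => lift (a j ic.1) ic.2)).
  have -> : interp_preimage R = [set v | holds G v phi] by [].
  apply: (Pol_preserves_pp Pf ppphi (a := fun j ic => lift (a j ic.1) ic.2)) => j.
  rewrite -phiE; split=> [i|]; first by have [] := liftP (a j i).
  by congr R: (aR j); apply/funext => i; have [_] := liftP (a j i).
move=> _; congr R; apply/funext => i /=.
rewrite /h (indI Pf (a := fun j => lift (a j i))) => [|j]; last by have [] := liftP (a j i).
by congr (xi _); apply/funext => j; have [_] := liftP (a j i).
Qed.

Hypotheses (enumD : enumerable D) (oligG : oligomorphic G).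

(** The finitely many values at given points of operations in the image of
    [Pol G] form a relation of the expansion. *)
Lemma expansion_dense : Pol expansion `<=` closure (ops_map xi @` Pol G).
Proof.
move=> [k g] Pg; apply/closure_ops => V x; have [[_ xiproj xicomp] _] := xicont.
pose R : set ('I_#|V| -> E) := [set u | exists2 f : op D k, Pol G (existT _ k f) &
  forall i, u i = xi f (x (enum_val i))].
have ppR : pp_definable G (interp_preimage R).
  apply: preserved_pp_definable => // m f Pf v vR.
  have vS j i : S (fun c => v j (i, c)) by have [] := vR j.
  have /choice[F FP] : forall j, exists F : op D k, Pol G (existT _ k F) /\
      forall i, h (fun c => v j (i, c)) = xi F (x (enum_val i)).
    by move=> j; have [_ [F]] := vR j; exists F.
  have PF j : Pol G (existT _ k (F j)) by have [] := FP j.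
  split=> [i|]; first exact: (interp_dom_preserved Pf (a := fun j c => v j (i, c))).
  exists (comp_op f F); first exact: Pol_comp.
  move=> i; rewrite xicomp // /h (indI Pf (a := fun j c => v j (i, c))); last first.
    by move=> j; exact: vS.
  by rewrite /comp_op; congr (xi f); apply/funext => j; have [_] := FP j.
have [gr _] := (PolP _ _).1 Pg.
have := gr (inr (exist _ (existT _ #|V| R) ppR)) (fun j i => x (enum_val i) j).
case=> [j|f Pf fP /=].
  exists (proj_op j); last by move=> i; rewrite xiproj.
  by apply: (@Pol_unary _ _ G id).
exists (xi f); first by exists (existT _ k f).
by move=> i; have := fP (enum_rank i); rewrite enum_rankK.
Qed.

(** Automorphisms of [G] act on [E] through [xi], and the coordinate map sends
    orbits of tuples into orbits. *)
Lemma expansion_oligomorphic : oligomorphic expansion.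
Proof.
move=> V; have [n [l lP]] := oligG (V * 'I_(idim I))%type.
have [lift liftP] := interp_section.
exists n, (fun i x => h (fun c => l i (x, c))) => v.
have [i [alpha aut lv]] := lP (fun xc => lift (v xc.1) xc.2).
exists i; exists (fun e => @xi 0 (unary alpha ord0) (fun=> e)).
  by apply: clone_homomorphism_isomorphism aut; case: expansion_clone_homomorphism.
have [alpha' [aK _ ha ha']] := aut.
apply/funext => x /=.
have lE c : alpha (l i (x, c)) = lift (v x) c.
  exact: (congr1 (fun u => u (x, c)) lv).
have lS : S (fun c => l i (x, c)).
  have -> : (fun c => l i (x, c)) = fun c => alpha' (lift (v x) c).
    by apply/funext => c; rewrite -lE aK.
  apply: (interp_dom_preserved (Pol_unary (@ord0 0) ha') (a := fun=> lift (v x))) => _.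
  by have [] := liftP (v x).
have /= <- := indI (Pol_unary (@ord0 0) ha) (fun=> lS).
have [_ <-] := liftP (v x); congr h; apply/funext => c.
exact: lE.
Qed.

Lemma expansion_countable_signature :
  countable_signature s -> countable_signature t -> countable_signature expansion_signature.
Proof.
move=> [cr cf] ct; split=> //.
have code n : {c : formula t ('I_n * 'I_(idim I)) -> nat | injective c}.
  apply: cid.
  have /countable_injP[c c_inj] := countable_formula ct
    (countableP [set: 'I_n * 'I_(idim I)]).
  by exists c => x y; apply: c_inj; exact: mem_set.
pose fml (x : {nR : {n & set ('I_n -> E)} | pp_definable G (interp_preimage (projT2 nR))}) :=
  cid2 (svalP x).
have /countable_injP[c c_inj] := cr.
(* The parity of the code separates the two kinds of relation symbols. *)
apply/countable_injP; exists (fun r : relsym s + _ => match r with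
  | inl r => (c r).*2
  | inr x => (CodeSeq.code [:: projT1 (sval x); sval (code _) (s2val (fml x))]).*2.+1
  end).
move=> [r|x] [r'|y] _ _ E1.
- by congr inl; apply: c_inj; rewrite ?inE //; exact: double_inj.
- by have := congr1 odd E1; rewrite /= !odd_double.
- by have := congr1 odd E1; rewrite /= !odd_double.
congr inr; have := double_inj (succn_inj E1) => /code_seq_inj.
case: x {E1} => [[n R] ppR]; case: y => [[n' R'] ppR'] /=.
set F := fml _; set F' := fml _ => -[nn']; subst n'.
move=> /(svalP (code n)) FF'; apply: eq_exist.
congr existT; apply: interp_preimage_inj.
by rewrite (s2valP' F) (s2valP' F') FF'.
Qed.

End Induced_homomorphism.

(** * The two characterizations *)

Lemma reduct_Pol (s s' : signature) (E : pointedType) (H : structure s E)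
    (H' : structure s' E) :
  reduct H H' -> Pol H' `<=` Pol H.
Proof.
move=> [iR [iF [_ _ rE fE]]] [m f] /PolP[fr ff]; apply/PolP; split.
  move=> r; pose Q (x : {n & set ('I_n -> E)}) := preserves f (projT2 x).
  have : Q (existT (fun n => set ('I_n -> E)) _ (@relI _ _ H' (iR r))) by exact: fr.
  by rewrite rE.
move=> g; pose Q (x : {n & ('I_n -> E) -> E}) := forall a : 'I_m.+1 -> 'I_(projT1 x) -> E,
  f (fun j => projT2 x (a j)) = projT2 x (fun i => f (fun j => a j i)).
have : Q (existT (fun n => ('I_n -> E) -> E) _ (@funI _ _ H' (iF g))) by exact: ff.
by rewrite fE.
Qed.

Lemma interpretation_finite (s t : signature) (D E : Type) (H : structure s E)
    (G : structure t D) (I : interpretation H G) :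
  finite_set [set: D] -> finite_set [set: E].
Proof.
move=> /(@finite_seqP {classic D})[d dP].
have dD (x : D) : (x : {classic D}) \in d by have : [set` d] x by rewrite -dP.
have [e0|noE] := pselect (exists e : E, True); last first.
  rewrite (_ : [set: E] = set0) //; apply/seteqP; split=> e // _.
  by case: noE; exists e.
have [x0 _] : exists x : D, True.
  have [e _] := e0; have [a _ _] := icoord_surj I e.
  by exists (a (Ordinal (idim_gt0 I))).
have vd x : index (x : {classic D}) d < size d by rewrite index_mem dD.
apply: (@sub_finite_set _ _ [set icoord I (fun c => nth x0 d (u c)) |
  u in [set: {ffun 'I_(idim I) -> 'I_(size d)}]]); last exact/finite_image/finite_finset.
move=> e _; have [a _ <-] := icoord_surj I e.
exists [ffun c => Ordinal (vd (a c))] => //; congr icoord; apply/funext => c.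
by rewrite ffunE; apply: (@nth_index {classic D}); exact: dD.
Qed.

(** The composite of the coordinate maps, being primitive positive definable, is
    respected by the polymorphisms of [G]; it is onto, so the composite of the
    induced homomorphisms fixes each polymorphism. *)
Lemma composite_graph_cancel (s t : signature) (D E : pointedType)
    (H : structure s E) (G : structure t D) (I : interpretation H G)
    (J : interpretation G H) (xi : forall k, op D k -> op E k)
    (zeta : forall k, op E k -> op D k) (m : nat) (f : op D m) :
  pp_definable G (composite_graph J I) ->
  clone_homomorphism (Pol G) (Pol H) xi -> induces I xi -> induces J zeta ->
  Pol G (existT _ m f) -> zeta m (xi m f) = f.
Proof.
move=> [phi ppphi phiE] [xipol _ _] indI indJ Pf; apply/funext => z.
have /choice[v vP] : forall j, exists v, composite_graph J I v /\ v None = z j.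
  move=> j; have [b Jb bz] := icoord_surj J (z j).
  have /choice[a aP] : forall i, exists a, interp_dom I a /\ icoord I a = b i.
    by move=> i; have [a Ia ab] := icoord_surj I (b i); exists a.
  have ab : (fun i => icoord I (a i)) = b by apply/funext => i; have [] := aP i.
  exists (oapp (fun ij => a ij.1 ij.2) (z j)); split=> //; split=> /=.
  - by move=> i; have [] := aP i.
  - by rewrite ab.
  - by rewrite ab.
have vI j i : interp_dom I (fun c => v j (Some (i, c))).
  by have [[/(_ i)]] := vP j.
have : composite_graph J I (fun o => f (fun j => v j o)).
  have E1 : composite_graph J I = [set v | holds G v phi] := phiE.
  rewrite E1; apply: (Pol_preserves_pp Pf ppphi) => j.
  by rewrite -E1; have [] := vP j.
case=> _ _ /=.
rewrite (_ : (fun j => v j None) = z); last by apply/funext => j; have [] := vP j.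
rewrite (_ : (fun i => icoord I _) =
    fun i => xi m f (fun j => icoord I (fun c => v j (Some (i, c))))); last first.
  apply/funext => i.
  exact: (indI _ _ Pf (fun j c => v j (Some (i, c)))).
rewrite (indJ _ _ (xipol _ Pf) (fun j i => icoord I (fun c => v j (Some (i, c))))).
  move=> ->; congr (zeta m _); apply/funext => j.
  by have [[_ _ ->]] := vP j.
by move=> j; have [[]] := vP j.
Qed.

(** An operation [f] of [Pol H] respects the graph, since its actions along [J]
    and then [I] are those of [zeta m f] and of [xi m (zeta m f) = f]. *)
Lemma cancel_composite_graph (s t : signature) (D E : pointedType)
    (H : structure s E) (G : structure t D) (I : interpretation H G)
    (J : interpretation G H) (xi : forall k, op D k -> op E k)
    (zeta : forall k, op E k -> op D k) :
  enumerable E -> oligomorphic H -> pp_interpretation I -> pp_interpretation J ->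
  clone_homomorphism (Pol H) (Pol G) zeta -> induces I xi -> induces J zeta ->
  (forall m (f : op E m), Pol H (existT _ m f) -> xi m (zeta m f) = f) ->
  pp_definable H (composite_graph I J).
Proof.
move=> Ee olig ppI ppJ [zpol _ _] indI indJ cancel.
apply: preserved_pp_definable => // m f Pf v vP.
have vJ i j : interp_dom J (fun c => v j (Some (i, c))) by have [] := vP j.
have E1 : (fun i => icoord J (fun c => f (fun j => v j (Some (i, c))))) =
    fun i => zeta m f (fun j => icoord J (fun c => v j (Some (i, c)))).
  by apply/funext => i; exact: (indJ _ _ Pf (fun j c => v j (Some (i, c)))).
have vI j : interp_dom I (fun i => icoord J (fun c => v j (Some (i, c)))).
  by have [] := vP j.
split=> /=.
- move=> i; exact: (interp_dom_preserved ppJ Pf (a := fun j c => v j (Some (i, c)))).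
- rewrite E1; apply: (interp_dom_preserved ppI (zpol _ Pf)
    (a := fun j i => icoord J (fun c => v j (Some (i, c))))).
  exact: vI.
- rewrite E1 (indI _ _ (zpol _ Pf)
    (fun j i => icoord J (fun c => v j (Some (i, c)))) vI) cancel //.
  by congr f; apply/funext => j; have [_ _ ->] := vP j.
Qed.

Lemma topological_clone_isomorphic_interpretation (s t : signature)
    (D E : pointedType) (H : structure s E) (G : structure t D)
    (xi : forall k, op D k -> op E k) (zeta : forall k, op E k -> op D k) :
  enumerable D -> oligomorphic G -> oligomorphic H ->
  continuous_clone_homomorphism (Pol G) (Pol H) xi ->
  clone_homomorphism (Pol H) (Pol G) zeta ->
  {in Pol H, cancel (ops_map zeta) (ops_map xi)} ->
  exists I : interpretation H G, pp_interpretation I /\ induces I xi.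
Proof.
move=> De oligG oligH xicont [zpol _ _] zetaK.
apply: clone_homomorphism_interpretation oligH _ xicont _ => //.
move=> f Pf; apply: subset_closure; exists (ops_map zeta f); first exact: zpol.
by apply: zetaK; exact: mem_set.
Qed.

Theorem theorem1 (sG sD : signature) (D E : pointedType)
    (Gamma : structure sG D) (Delta : structure sD E)
    (hGamma : finite_or_omega_categorical Gamma)
    (hDelta : finite_or_omega_categorical Delta) :
  (pp_interpretable Delta Gamma <->
   exists (s' : signature) (Delta' : structure s' E),
     [/\ reduct Delta Delta',
         finite_or_omega_categorical Delta' &
         exists xi : forall k, op D k -> op E k,
           continuous_clone_homomorphism (Pol Gamma) (Pol Delta') xi /\
           Pol Delta' `<=` closure (ops_map xi @` Pol Gamma)]) /\
  (pp_bi_interpretable Gamma Delta <->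
   topological_clone_isomorphic (Pol Gamma) (Pol Delta)).
Proof.
have [enumD oligG] := finite_or_omega_categorical_oligomorphic hGamma.
have [enumE oligE] := finite_or_omega_categorical_oligomorphic hDelta.
split; split.
- move=> [I ppI].
  have [xi [xicont indI]] := interpretation_clone_homomorphism ppI.
  exists (expansion_signature I), (expansion I); split.
  + exact: reduct_expansion.
  + have [Efin|[Enat cE _]] := hDelta; first by left.
    have [Dfin|[_ cD _]] := hGamma; first by left; exact: interpretation_finite I Dfin.
    right; apply: oligomorphic_omega_categorical => //.
      exact: expansion_countable_signature.
    exact: (expansion_oligomorphic ppI indI xicont).
  + exists xi; split; first exact: expansion_clone_homomorphism.
    exact: expansion_dense.
- move=> [s' [Delta' [red hDelta' [xi [xicont dense]]]]].
  have [_ oligE'] := finite_or_omega_categorical_oligomorphic hDelta'.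
  have [I [ppI _]] := clone_homomorphism_interpretation enumD oligG oligE'
    (reduct_Pol red) xicont dense.
  by exists I.
- move=> [I [J [ppI ppJ defH defG]]].
  have [xi [xicont indI]] := interpretation_clone_homomorphism ppI.
  have [zeta [zcont indJ]] := interpretation_clone_homomorphism ppJ.
  exists xi, zeta; split=> //.
    move=> [m f] /set_mem Pf; congr existT.
    by apply: (composite_graph_cancel defG) indJ Pf => //; case: xicont.
  move=> [m f] /set_mem Pf; congr existT.
  by apply: (composite_graph_cancel defH) indI Pf => //; case: zcont.
- move=> [xi [zeta [xicont zcont xiK zetaK]]].
  have [zhom _] := zcont; have [xihom _] := xicont.
  have [I [ppI indI]] := topological_clone_isomorphic_interpretation
    enumD oligG oligE xicont zhom zetaK.
  have [J [ppJ indJ]] := topological_clone_isomorphic_interpretation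
    enumE oligE oligG zcont xihom xiK.
  exists I, J; split=> //.
    apply: (cancel_composite_graph enumE oligE ppI ppJ zhom indI indJ) => m f Pf.
    exact: existT_inj2 (zetaK _ (mem_set Pf)).
  apply: (cancel_composite_graph enumD oligG ppJ ppI xihom indJ indI) => m f Pf.
  exact: existT_inj2 (xiK _ (mem_set Pf)).
Qed.
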